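(* Let $G$ be a Polish group. Then the pair $(E^Z_G,\mathrm{Disj}_G)$ is complete for the class $\mathcal C_G$; in particular $E^Z_G$ is a $\le_B$-maximum element of $\mathcal C_G$.
   Context: $\mathcal C_G$ is the class of orbit equivalence relations $E^X_G$ ($xE^X_Gy\iff\exists g\in G\;g\cdot x=y$) induced by Borel actions of $G$ on standard Borel spaces $X$. Fix a Polish space $X_0$ (e.g. the Urysohn space or $\mathbb R^\omega$) into which every Polish space embeds as a closed subspace. $Z$ is the standard Borel space of non-empty closed subsets of $X_0\times G$ with the Effros–Borel structure, with the Borel action $g.F=\{(x,gh):(x,h)\in F\}$, and $E^Z_G$ is the induced orbit equivalence relation. For $F\in Z$, $A(F)=\{x\in X_0:\exists g\in G\,(x,g)\in F\}$, and $F\,\mathrm{Disj}_G\,F'$ iff $A(F)\cap A(F')=\emptyset$. A Borel homomorphism from a pair $(R_1,R_2)$ of relations on standard Borel $X$ to a pair $(S_1,S_2)$ on $Y$ is a Borel $f:X\to Y$ with $xR_iy\Rightarrow f(x)S_if(y)$, $i=1,2$. A pair $(R_1,R_2)$ is complete for a class $\mathcal C$ if every $R\in\mathcal C$ admits a Borel homomorphism from $(R,\neg R)$ to $(R_1,R_2)$ and some $R\in\mathcal C$ admits a Borel homomorphism from $(R_1,R_2)$ to $(R,\neg R)$. $E\le_B F$ means there is a Borel $f$ with $xEy\iff f(x)Ff(y)$. *)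

(* Defs.v *)
From HB Require Import structures.
From mathcomp Require Import all_boot all_order.
From mathcomp Require Import boolp classical_sets functions cardinality.
From mathcomp Require Import topology measure.
From Stdlib Require Import Rdefinitions Raxioms.
Set Implicit Arguments. Unset Strict Implicit. Unset Printing Implicit Defensive.
Local Open Scope classical_set_scope.

Definition is_metric (T : Type) (d : T -> T -> R) : Prop :=
  (forall x y, Rle 0%R (d x y)) /\
  (forall x y, d x y = 0%R <-> x = y) /\
  (forall x y, d x y = d y x) /\
  (forall x y z, Rle (d x z) (Rplus (d x y) (d y z))).

Definition metric_open (T : Type) (d : T -> T -> R) : set (set T) :=
  [set U | forall x, U x -> exists e, Rlt 0%R e /\ (forall y, Rlt (d x y) e -> U y)].

Definition metric_complete (T : Type) (d : T -> T -> R) : Prop :=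
  forall u : nat -> T,
    (forall e, Rlt 0%R e -> exists N, forall m n, (N <= m)%N -> (N <= n)%N ->
        Rlt (d (u m) (u n)) e) ->
    exists l, forall e, Rlt 0%R e -> exists N, forall n, (N <= n)%N -> Rlt (d (u n) l) e.

Definition polish_top (T : Type) (op : set (set T)) : Prop :=
  exists d : T -> T -> R, is_metric d /\ metric_complete d /\ op = metric_open d /\
    exists D : set T, countable D /\
      forall U, op U -> U !=set0 -> (D `&` U) !=set0.

Definition standard_borel (X : Type) (S : set (set X)) : Prop :=
  exists op : set (set X), polish_top op /\ S = <<s op>>.

Definition borel_sets (T : topologicalType) : set (set T) := <<s [set U | open U]>>.

Definition prod_sigma (A B : Type) (SA : set (set A)) (SB : set (set B))
  : set (set (A * B)) :=
  <<s [set C | exists U V, SA U /\ SB V /\ C = U `*` V]>>.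

Definition meas_map (X Y : Type) (SX : set (set X)) (SY : set (set Y)) (f : X -> Y)
  : Prop := forall B, SY B -> SX (f @^-1` B).

Definition group_axioms (G : Type) (mul : G -> G -> G) (inv : G -> G) (one : G) : Prop :=
  (forall a b c, mul a (mul b c) = mul (mul a b) c) /\
  (forall a, mul one a = a) /\ (forall a, mul a one = a) /\
  (forall a, mul (inv a) a = one) /\ (forall a, mul a (inv a) = one).

Definition polish_group (G : topologicalType) (mul : G -> G -> G) (inv : G -> G) (one : G)
  : Prop :=
  group_axioms mul inv one /\
  continuous (fun p : G * G => mul p.1 (inv p.2)) /\
  polish_top [set U : set G | open U].

Definition borel_action (G : topologicalType) (mul : G -> G -> G) (one : G)
  (X : Type) (SX : set (set X)) (act : G -> X -> X) : Prop :=
  (forall x, act one x = x) /\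
  (forall g h x, act (mul g h) x = act g (act h x)) /\
  meas_map (prod_sigma (@borel_sets G) SX) SX (fun p : G * X => act p.1 p.2).

Definition orbit_rel (G X : Type) (act : G -> X -> X) : X -> X -> Prop :=
  fun x y => exists g, act g x = y.

Definition in_CG (G : topologicalType) (mul : G -> G -> G) (one : G)
  (X : Type) (SX : set (set X)) (E : X -> X -> Prop) : Prop :=
  standard_borel SX /\
  exists act : G -> X -> X, borel_action mul one SX act /\
    forall x y, E x y <-> orbit_rel act x y.

Definition borel_hom (X Y : Type) (SX : set (set X)) (SY : set (set Y))
  (R1 R2 : X -> X -> Prop) (S1 S2 : Y -> Y -> Prop) (f : X -> Y) : Prop :=
  meas_map SX SY f /\
  (forall x y, R1 x y -> S1 (f x) (f y)) /\
  (forall x y, R2 x y -> S2 (f x) (f y)).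

Definition neg_rel (X : Type) (R : X -> X -> Prop) : X -> X -> Prop :=
  fun x y => ~ R x y.

Definition complete_for_CG (G : topologicalType) (mul : G -> G -> G) (one : G)
  (Y : Type) (SY : set (set Y)) (R1 R2 : Y -> Y -> Prop) : Prop :=
  (forall (X : Type) (SX : set (set X)) (E : X -> X -> Prop),
      in_CG mul one SX E ->
      exists f : X -> Y, borel_hom SX SY E (neg_rel E) R1 R2 f) /\
  (exists (X : Type) (SX : set (set X)) (E : X -> X -> Prop),
      in_CG mul one SX E /\
      exists f : Y -> X, borel_hom SY SX R1 R2 E (neg_rel E) f).

Definition borel_reducible (X Y : Type) (SX : set (set X)) (SY : set (set Y))
  (E : X -> X -> Prop) (F : Y -> Y -> Prop) : Prop :=
  exists f : X -> Y, meas_map SX SY f /\ forall x y, E x y <-> F (f x) (f y).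

Definition universal_polish (X0 : topologicalType) : Prop :=
  polish_top [set U : set X0 | open U] /\
  forall (T : Type) (op : set (set T)), polish_top op ->
    exists e : T -> X0, injective e /\ closed (range e) /\
      forall U, op U <-> exists V, open V /\ U = e @^-1` V.

Definition Zsp (X0 G : topologicalType) : Type :=
  {F : set (X0 * G) | closed F /\ F !=set0}.

Definition effros (X0 G : topologicalType) : set (set (Zsp X0 G)) :=
  <<s [set W | exists U : set (X0 * G), open U /\
                 W = [set F : Zsp X0 G | (proj1_sig F `&` U) !=set0]]>>.

Definition Zact_set (X0 G : topologicalType) (mul : G -> G -> G) (g : G)
  (F : set (X0 * G)) : set (X0 * G) :=
  (fun q : X0 * G => (q.1, mul g q.2)) @` F.

Definition EZ (X0 G : topologicalType) (mul : G -> G -> G) : Zsp X0 G -> Zsp X0 G -> Prop :=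
  fun F F' => exists g : G, Zact_set mul g (proj1_sig F) = proj1_sig F'.

Definition Aproj (X0 G : topologicalType) (F : Zsp X0 G) : set X0 :=
  [set x | exists g : G, proj1_sig F (x, g)].

Definition DisjG (X0 G : topologicalType) : Zsp X0 G -> Zsp X0 G -> Prop :=
  fun F F' => Aproj F `&` Aproj F' = set0.

(* Main.v *)
Require Import Defs.
From mathcomp Require Import all_boot all_order.
From mathcomp Require Import boolp classical_sets functions cardinality.
From mathcomp Require Import topology measure.
From Stdlib Require Import Reals Lra.
Set Implicit Arguments. Unset Strict Implicit. Unset Printing Implicit Defensive.
Local Open Scope classical_set_scope.

(** Becker and Kechris would first make the action continuous by refining the
    topology of [X].  It is enough to find a Borel map [psi] from [X] to [R^nat]
    that is continuous along each orbit and separates orbits: with [e] a closed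
    embedding of [R^nat] in [X0], [x] is sent to the closed set
    [{(e (psi (h^-1 x)), h) : h in G}].  The coordinates of [psi] are
    [inf {weight l : {g : g x in A_n} is nonmeager in a V_l}], where the [A_n] are
    Borel sets separating points, [a] runs over a dense sequence of [G], and
    [V_l = V_{l_1} ... V_{l_k}] has weight [sum 2^-l_j] for a neighbourhood base
    [V_i] of the identity with [V_{i+1}^3 <= V_i], as in the Birkhoff-Kakutani
    theorem.  Vaught's category quantifier makes them Borel, appending [i] to [l]
    makes them continuous along orbits, and the Baire category theorem makes them
    separate orbits.

    The Effros Borel structure is standard because a closed set is coded, by the
    basic open sets that it meets together with least refining witnesses, as a
    point of a closed subset of the Baire space. *)

Local Arguments INR : simpl never.

(** * Sigma-algebras *)

Section SigmaAlgebra.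
Variables (T : Type) (S : set (set T)).
Hypothesis HS : sigma_algebra setT S.

Lemma salgC A : S A -> S [set x | ~ A x].
Proof. by case: HS => _ + _ => /[apply]; rewrite setTD. Qed.

Lemma salg_cst (P : Prop) : S [set _ | P].
Proof.
case: HS => S0 SC _; have [p|np] := pselect P.
  rewrite (_ : mkset _ = setT `\` set0); first exact: SC.
  by rewrite setD0; apply/seteqP; split => x.
by rewrite (_ : mkset _ = set0)//; apply/seteqP; split => x.
Qed.

Lemma salg_ex (I : countType) (A : I -> set T) :
  (forall i, S (A i)) -> S [set x | exists i, A i x].
Proof.
move=> SA; case: HS => _ _ /(_ (fun n => [set x | exists2 i, unpickle n = Some i & A i x])) H.
have -> : [set x | exists i, A i x] =
    \bigcup_n [set x | exists2 i : I, unpickle n = Some i & A i x].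
  apply/seteqP; split => x /=; first by case=> i Ai; exists (pickle i) => //; exists i; rewrite ?pickleK.
  by case=> n _ [i _ Ai]; exists i.
apply: H => n; case: (unpickle n) => [i|].
  rewrite (_ : mkset _ = A i); first exact: SA.
  by apply/seteqP; split => x /=; [case=> ? [<-]|exists i].
rewrite (_ : mkset _ = [set _ | False]); first exact: salg_cst.
by apply/seteqP; split => x // [].
Qed.

Lemma salg_all (I : countType) (A : I -> set T) :
  (forall i, S (A i)) -> S [set x | forall i, A i x].
Proof.
move=> SA; rewrite (_ : mkset _ = [set x | ~ exists i, ~ A i x]).
  by apply/salgC/salg_ex => i; apply/salgC.
apply/seteqP; split => x /=; first by move=> Ax [i]; apply.
by move=> nA i; apply: contrapT => nAi; apply: nA; exists i.
Qed.

Lemma salg_or A B : S A -> S B -> S [set x | A x \/ B x].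
Proof.
move=> SA SB; rewrite (_ : mkset _ = [set x | exists b : bool, (if b then A else B) x]).
  by apply: salg_ex; case.
apply/seteqP; split => x /=; first by case=> ?; [exists true|exists false].
by case=> -[] ?; [left|right].
Qed.

Lemma salg_and A B : S A -> S B -> S [set x | A x /\ B x].
Proof.
move=> SA SB; rewrite (_ : mkset _ = [set x | forall b : bool, (if b then A else B) x]).
  by apply: salg_all; case.
apply/seteqP; split => x /=; first by case=> ? ? [].
by move=> H; split; [exact: (H true)|exact: (H false)].
Qed.

Lemma salg_imp (P : Prop) A : S A -> S [set x | P -> A x].
Proof.
move=> SA; have [p|np] := pselect P.
  by rewrite (_ : mkset _ = A)//; apply/seteqP; split => x /=; auto.
rewrite (_ : mkset _ = [set _ | True]); first exact: salg_cst.
by apply/seteqP; split => x /=.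
Qed.

End SigmaAlgebra.

Lemma salg_gen (T : Type) (G : set (set T)) : sigma_algebra setT <<s G>>.
Proof. exact: smallest_sigma_algebra. Qed.

(** The empty set comes for free once a generator exists, as the complement of the union of that
    generator and its complement. The right alternative of the last premise serves families that may
    be empty. *)
Lemma salg_ind (T : Type) (G P : set (set T)) :
  G `<=` P -> (forall A, P A -> P (~` A)) ->
  (forall A : nat -> set T, (forall n, P (A n)) -> P (\bigcup_n A n)) ->
  G !=set0 \/ P set0 -> <<s G>> `<=` P.
Proof.
move=> GP PC PU P0; apply: smallest_sub => //; split=> //.
- case: P0 => // -[A /GP PA].
  have P2 : P (\bigcup_(n : nat) (if n is 0 then A else ~` A)) by apply: PU => -[|n]; auto.
  have E : \bigcup_(n : nat) (if n is 0 then A else ~` A) = setT.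
    apply/seteqP; split => // x _; have [Ax|nAx] := pselect (A x).
      by exists 0%nat.
    by exists 1%nat.
  by rewrite -[set0]setCT -E; apply: PC.
- by move=> A PA; rewrite setTD; exact: PC.
Qed.

Lemma salg_preimage (X Y : Type) (S : set (set X)) (G : set (set Y)) (f : X -> Y) :
  sigma_algebra setT S -> (forall B, G B -> S (f @^-1` B)) ->
  meas_map S <<s G>> f.
Proof.
move=> HS HG; apply: salg_ind => //.
- by move=> A SA; exact: (salgC HS SA).
- move=> A SA; rewrite (_ : _ @^-1` _ = [set x | exists n, A n (f x)]).
    exact: (salg_ex HS (A := fun n => f @^-1` A n)).
  by apply/seteqP; split => x /= [n]; exists n.
- by right; rewrite preimage_set0; case: HS.
Qed.

(** * Countable bases of Polish spaces *)

Lemma inv_lt (e : R) : (0 < e)%R -> exists n : nat, (/ INR n.+1 < e)%R.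
Proof.
move=> e0; have [[|N] [h1 /ltP h2]] := archimed_cor1 e e0; first by [].
by exists N.
Qed.

Lemma inv_pos (n : nat) : (0 < / INR n.+1)%R.
Proof. by apply: Rinv_0_lt_compat; apply: lt_0_INR; apply/ltP. Qed.

Lemma inv_le (m n : nat) : (m <= n)%N -> (/ INR n.+1 <= / INR m.+1)%R.
Proof.
move=> mn; apply: Rinv_le_contravar; first by apply: lt_0_INR; apply/ltP.
by apply: le_INR; apply/leP.
Qed.

Lemma metric_ball_open (T : Type) (d : T -> T -> R) (x : T) (r : R) :
  is_metric d -> metric_open d [set y | (d x y < r)%R].
Proof.
move=> [_ [_ [_ dtri]]] y /= h; exists (r - d x y)%R; split; first lra.
by move=> z hz; have := dtri x y z; lra.
Qed.

Lemma polish_base (T : Type) (op : set (set T)) : polish_top op ->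
  exists d : T -> T -> R, [/\ is_metric d, metric_complete d, op = metric_open d &
   exists B : nat -> set T, [/\ B 0%N = setT, forall n, op (B n) &
    forall x e, (0 < e)%R -> exists n, B n x /\ forall y, B n y -> (d x y < e)%R]].
Proof.
move=> [d [md [cd [-> [D [/countable_injP [f finj] Dd]]]]]].
have [dpos [d0 [dsym dtri]]] := md.
have ballo c r : metric_open d [set y | (d c y < r)%R] by exact: metric_ball_open.
exists d; split => //.
(* Index 0 is reserved for the whole space, which every non-empty closed set meets. A centre is
   named by its number under the injection [f], so [D] need not be enumerated; indices that decode
   to nothing give the whole space again. *)
pose B n := match n with 0 => setT | n.+1 =>
  match (unpickle n : option (nat * nat)) with
  | Some (k, m) => [set y | exists c, [/\ D c, f c = k & (d c y < / INR m.+1)%R]]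
  | None => setT end end.
exists B; split => //.
- move=> [|n] /=; first by move=> x _; exists 1%R; split; [lra|].
  case: (unpickle n) => [[k m] y [c [Dc fc h]]|]; last by move=> x _; exists 1%R; split; [lra|].
  have [e [e0 he]] := ballo c _ _ h; exists e; split => // z /he hz.
  by exists c.
- move=> x e e0.
  have [m hm] : exists m : nat, (/ INR m.+1 < e / 2)%R by apply: inv_lt; lra.
  have [] := Dd _ (ballo x (/ INR m.+1)%R).
    by exists x => /=; rewrite (d0 x x).2//; exact: inv_pos.
  move=> c [Dc]; rewrite [in X in X -> _]/mkset => xc; exists (pickle (f c, m)).+1; rewrite /B pickleK; split.
    by exists c; split => //; rewrite dsym.
  move=> y [c' [Dc' ff h]].
  have cc : c' = c by apply: finj => //; rewrite inE.
  by rewrite cc in h; have := dtri x c y; lra.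
Qed.

(** * Metrics induced by real codes *)

Section CodedMetric.
Variables (T : Type) (c : T -> nat -> R).

(** Capping the difference at [/ INR n.+1] makes the supremum over [n] finite and a metric for
    pointwise convergence of codes. *)
Definition code_gap (s t : T) (n : nat) : R :=
  Rmin (Rabs (c s n - c t n)) (/ INR n.+1).

Lemma code_gap_ge0 s t n : (0 <= code_gap s t n)%R.
Proof. by apply: Rmin_glb; [exact: Rabs_pos|have := inv_pos n; lra]. Qed.

Definition code_gaps (s t : T) : R -> Prop := fun r => exists n, r = code_gap s t n.

Lemma code_gaps_bound s t : bound (code_gaps s t).
Proof.
exists 1%R => _ [n ->]; apply: Rle_trans (Rmin_r _ _) _.
by have := inv_le (leq0n n); rewrite -[INR 1]/1%R Rinv_1.
Qed.

Lemma code_gaps_inhab s t : exists r, code_gaps s t r.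
Proof. by exists (code_gap s t 0); exists 0%N. Qed.

Definition cdist (s t : T) : R :=
  proj1_sig (completeness _ (code_gaps_bound s t) (code_gaps_inhab s t)).

Lemma cdist_le s t r : (cdist s t <= r)%R <-> forall n, (code_gap s t n <= r)%R.
Proof.
rewrite /cdist; case: completeness => m [ub lub] /=; split.
  by move=> mr n; apply: Rle_trans mr; apply: ub; exists n.
by move=> h; apply: lub => _ [n ->].
Qed.

Lemma code_gap_le s t n : (code_gap s t n <= cdist s t)%R.
Proof. exact: ((cdist_le s t _).1 (Rle_refl _)). Qed.

Lemma code_gap_close s t n : (cdist s t < / INR n.+1)%R ->
  (Rabs (c s n - c t n) <= cdist s t)%R.
Proof.
have := code_gap_le s t n; rewrite /code_gap /Rmin.
by case: Rle_dec => //; lra.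
Qed.

Hypothesis cinj : injective c.

Lemma cdist_metric : is_metric cdist.
Proof.
have ge0 s t : (0 <= cdist s t)%R.
  by apply: Rle_trans (code_gap_ge0 s t 0) _; exact: code_gap_le.
split=> //; split; [|split].
- move=> s t; split.
    move=> d0; apply: cinj; apply/funext => n.
    have := @code_gap_close s t n; rewrite d0 => /(_ (inv_pos n)).
    by rewrite /Rabs; case: Rcase_abs; lra.
  move=> <-; apply: Rle_antisym => //; apply/cdist_le => n.
  by rewrite /code_gap Rminus_diag Rabs_R0; exact: Rmin_l.
- have H s t : (cdist s t <= cdist t s)%R.
    apply/cdist_le => n; have := code_gap_le t s n.
    by rewrite /code_gap Rabs_minus_sym.
  by move=> s t; apply: Rle_antisym.
- move=> x y z; apply/cdist_le => n.
  have := code_gap_le x y n; have := code_gap_le y z n.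
  have := Rabs_triang (c x n - c y n) (c y n - c z n).
  have -> : (c x n - c y n + (c y n - c z n) = c x n - c z n)%R by lra.
  have := Rabs_pos (c x n - c y n); have := Rabs_pos (c y n - c z n); have := inv_pos n.
  by rewrite /code_gap /Rmin; repeat case: Rle_dec; lra.
Qed.

(** By the cap, coordinates from [N] on contribute at most [/ INR N.+1], so a ball constrains only
    finitely many coordinates. *)
Lemma cdist_openP (U : set T) : metric_open cdist U <->
  forall t, U t -> exists N e, (0 < e)%R /\
    forall t', (forall i, (i < N)%N -> (Rabs (c t i - c t' i) < e)%R) -> U t'.
Proof.
split=> H t /H.
- move=> [e [e0 he]]; have [N hN] : exists n : nat, (/ INR n.+1 < e / 2)%R.
    by apply: inv_lt; lra.
  exists N, (e / 2)%R; split; [lra|] => t' ht'; apply: he.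
  apply: (@Rle_lt_trans _ (e / 2)%R); last lra.
  apply/cdist_le => n; rewrite /code_gap; have [nN|Nn] := ltnP n N.
    by apply: Rle_trans (Rmin_l _ _) _; have := ht' _ nN; lra.
  by apply: Rle_trans (Rmin_r _ _) _; have := inv_le Nn; lra.
- move=> [N [e [e0 he]]]; exists (Rmin e (/ INR N.+1))%R; split.
    by apply: Rmin_glb_lt => //; exact: inv_pos.
  move=> t' ht'; apply: he => i iN.
  have h1 := Rmin_l e (/ INR N.+1); have h2 := Rmin_r e (/ INR N.+1).
  have h3 := inv_le (ltnW iN).
  by have := @code_gap_close t t' i; lra.
Qed.

Definition box_index := (seq (nat * nat * nat) * nat)%type.

(** Triples of naturals code the rationals, with repetitions; this keeps [box_index] a countable
    type, as [salg_ex] requires. *)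
Definition frac_of (p : nat * nat * nat) : R :=
  ((INR p.1.1 - INR p.1.2) / INR p.2.+1)%R.

Lemma frac_of_dense r e : (0 < e)%R -> exists p, (Rabs (r - frac_of p) < e)%R.
Proof.
move=> e0; have [k hk] := inv_lt e0.
have k0 : (0 < INR k.+1)%R by apply: lt_0_INR; apply/ltP.
have [h1 h2] := archimed (r * INR k.+1)%R.
set z := up _ in h1 h2.
have [a [b hab]] : exists a b : nat, IZR z = (INR a - INR b)%R.
  case: z {h1 h2} => [|p|p].
  - by exists 0%N, 0%N; rewrite -[INR 0]/0%R; lra.
  - by exists (Pos.to_nat p), 0%N; rewrite INR_IZR_INZ Znat.positive_nat_Z -[INR 0]/0%R; lra.
  - exists 0%N, (Pos.to_nat p); rewrite [INR (Pos.to_nat p)]INR_IZR_INZ Znat.positive_nat_Z -[INR 0]/0%R.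
    by rewrite -[Z.neg p]/(Z.opp (Z.pos p)) opp_IZR; lra.
exists (a, b, k); rewrite /frac_of /= -hab.
have -> : (r - IZR z / INR k.+1 = - ((IZR z - r * INR k.+1) * / INR k.+1))%R.
  by field; lra.
rewrite Rabs_Ropp Rabs_mult Rabs_inv (Rabs_pos_eq (INR k.+1)); last lra.
rewrite Rabs_pos_eq; last lra.
apply: Rle_lt_trans hk; rewrite -[X in (_ <= X)%R]Rmult_1_l.
by apply: Rmult_le_compat_r; [have := inv_pos k; lra|lra].
Qed.

Definition frac0 : nat * nat * nat := (0, 0, 0)%N.

Definition box (w : box_index) : set T :=
  [set t | forall i, (i < size w.1)%N ->
     (Rabs (c t i - frac_of (seq.nth frac0 w.1 i)) < / INR w.2.+1)%R].

Lemma box_base (U : set T) t : metric_open cdist U -> U t ->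
  exists w, box w t /\ box w `<=` U.
Proof.
move=> /cdist_openP oU /oU [N [e [e0 he]]].
have [k hk] : exists n : nat, (/ INR n.+1 < e / 2)%R by apply: inv_lt; lra.
have /choice [q hq] : forall i, exists p, (Rabs (c t i - frac_of p) < / INR k.+1)%R.
  by move=> i; apply: frac_of_dense; exact: inv_pos.
exists (mkseq q N, k); split.
  by move=> i /=; rewrite size_mkseq => iN; rewrite nth_mkseq.
move=> t' /= ht'; apply: he => i iN; have := ht' i.
rewrite size_mkseq nth_mkseq// => /(_ iN); have := hq i.
have := Rabs_triang (c t i - frac_of (q i)) (frac_of (q i) - c t' i).
have -> : (c t i - frac_of (q i) + (frac_of (q i) - c t' i) = c t i - c t' i)%R by lra.
by rewrite (Rabs_minus_sym (frac_of _) (c t' i)) /=; lra.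
Qed.

(** Open sets are countable unions of boxes, and a box is cut out by half-lines in finitely many
    coordinates. *)
Lemma coded_meas (X : Type) (S : set (set X)) (f : X -> T) :
  sigma_algebra setT S ->
  (forall i r, S [set x | (c (f x) i < r)%R]) ->
  forall U, metric_open cdist U -> S (f @^-1` U).
Proof.
move=> HS Sf U oU.
have Sf' i r : S [set x | (r < c (f x) i)%R].
  rewrite (_ : mkset _ = [set x | exists n : nat, ~ (c (f x) i < r + / INR n.+1)%R]).
    by apply: (salg_ex HS) => n; exact: (salgC HS (Sf i _)).
  apply/seteqP; split => x /=; last by case=> n; have := inv_pos n; lra.
  move=> h; have [n hn] : exists n : nat, (/ INR n.+1 < c (f x) i - r)%R by apply: inv_lt; lra.
  by exists n; lra.
rewrite (_ : _ @^-1` _ = [set x | exists w, box w `<=` U /\ box w (f x)]).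
  apply: (salg_ex HS) => w; apply: (salg_and HS); first exact: (salg_cst HS).
  apply: (salg_all HS) => i; apply: (salg_imp HS).
  rewrite [X in S X](_ : _ = [set x |
    (c (f x) i < frac_of (seq.nth frac0 w.1 i) + / INR w.2.+1)%R /\
    (frac_of (seq.nth frac0 w.1 i) - / INR w.2.+1 < c (f x) i)%R]).
    exact: (salg_and HS (Sf _ _) (Sf' _ _)).
  apply/seteqP; split => x /=; first by move=> /Rabs_def2; lra.
  by move=> ?; apply: Rabs_def1; lra.
apply/seteqP; split => x /=; last by case=> w [+ ]; apply.
by move=> /(box_base oU) [w [h1 h2]]; exists w.
Qed.

(** The premise says that the range of [c] is closed for pointwise convergence. Coordinatewise
    limits of Cauchy sequences are then codes, and one point from each non-empty box gives a
    countable dense set. *)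
Lemma coded_polish :
  (forall z : nat -> R, (forall N e, (0 < e)%R -> exists t,
      forall i, (i < N)%N -> (Rabs (c t i - z i) < e)%R) -> exists t, c t = z) ->
  polish_top (metric_open cdist).
Proof.
move=> cclosed; exists cdist; split; first exact: cdist_metric.
have [dpos [d0 [dsym dtri]]] := cdist_metric.
split; last (split => //).
- move=> u uC.
  have /choice [z hz] : forall i, exists l, Un_cv (fun n => c (u n) i) l.
    move=> i; suff /R_complete [l] : Cauchy_crit (fun n => c (u n) i) by exists l.
    move=> e e0; have [N hN] := uC (Rmin e (/ INR i.+1)) ltac:(apply: Rmin_glb_lt; [lra|exact: inv_pos]).
    exists N => m n /leP Nm /leP Nn; have := hN m n Nm Nn.
    have h1 := Rmin_l e (/ INR i.+1); have h2 := Rmin_r e (/ INR i.+1).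
    rewrite /Rdist; have := @code_gap_close (u m) (u n) i; lra.
  have [l hl] : exists l, c l = z.
    apply: cclosed => N e e0.
    have : exists M : nat, forall n, (M <= n)%N -> forall i, (i < N)%N -> (Rabs (c (u n) i - z i) < e)%R.
      elim: N => [|N [M hM]]; first by exists 0%N.
      have [M' hM'] := hz N e e0; exists (maxn M M') => n.
      rewrite geq_max => /andP[h1 h2] i; rewrite ltnS leq_eqVlt => /orP[/eqP->|].
        by apply: hM'; apply/leP.
      exact: hM.
    by move=> [M hM]; exists (u M) => i; apply: hM.
  exists l => e e0; have [N hN] := uC (e / 2)%R ltac:(lra).
  exists N => n Nn; apply: (@Rle_lt_trans _ (e / 2)%R); last lra.
  apply/cdist_le => i; apply: le_epsilon => eps eps0.
  have [M hM] := hz i eps eps0.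
  have := hM (maxn M N) ltac:(apply/leP; exact: leq_maxl).
  have := hN n (maxn M N) Nn (leq_maxr _ _).
  have := code_gap_le (u n) (u (maxn M N)) i; rewrite /Rdist /code_gap -hl.
  have := Rabs_triang (c (u n) i - c (u (maxn M N)) i) (c (u (maxn M N)) i - c l i).
  have -> : (c (u n) i - c (u (maxn M N)) i + (c (u (maxn M N)) i - c l i) = c (u n) i - c l i)%R by lra.
  by rewrite /Rmin; repeat case: Rle_dec; lra.
- have [[t0 _]|ne] := pselect (exists t : T, True); last first.
    by exists set0; split => // U _ [t _]; case: ne; exists t.
  have /choice [h hh] : forall w, exists t, box w !=set0 -> box w t.
    by move=> w; have [[t ht]|nw] := pselect (box w !=set0); [exists t|exists t0].
  exists (range h); split.
    by by apply: (sub_countable (card_image_le _ _)); exact: countableP.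
  move=> U oU [t /(box_base oU) [w [wt wU]]].
  by exists (h w); split; [exists w|apply/wU/hh; exists t].
Qed.

End CodedMetric.

(** * The Effros Borel space *)

Lemma open_prodP (A B : topologicalType) (U : set (A * B)) :
  open U <-> forall p, U p -> exists V W,
    [/\ open V, open W, V p.1, W p.2 & V `*` W `<=` U].
Proof.
split.
  rewrite openE => oU p /oU [[V W] /= [nV nW] VW].
  exists V°, W°; split => //; [exact: open_interior|exact: open_interior|].
  by move=> q [/interior_subset ? /interior_subset ?]; apply: VW.
move=> H; rewrite openE => p /H [V [W [oV oW Vp Wp VW]]].
by exists (V, W) => //=; split; apply: open_nbhs_nbhs.
Qed.

Lemma polish_prod (A B : topologicalType) :
  polish_top [set U : set A | open U] -> polish_top [set U : set B | open U] ->
  polish_top [set U : set (A * B) | open U].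
Proof.
move=> [a [ma [ca [oa [DA [cDA dDA]]]]]] [b [mb [cb [ob [DB [cDB dDB]]]]]].
have [apos [a0 [asym atri]]] := ma; have [bpos [b0 [bsym btri]]] := mb.
have oaE U : open U <-> metric_open a U by rewrite -oa.
have obE U : open U <-> metric_open b U by rewrite -ob.
exists (fun p q => a p.1 q.1 + b p.2 q.2)%R; split; [|split; [|split]].
- split=> [p q|]; first by have := apos p.1 q.1; have := bpos p.2 q.2; lra.
  split; [|split].
  + move=> [x1 x2] [y1 y2] /=; split.
      have := apos x1 y1; have := bpos x2 y2 => h1 h2 h3.
      by congr pair; [apply/a0|apply/b0]; lra.
    by case=> -> ->; rewrite ((a0 y1 y1).2 erefl) ((b0 y2 y2).2 erefl); lra.
  + by move=> p q; rewrite asym bsym.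
  + by move=> p q r; have := atri p.1 q.1 r.1; have := btri p.2 q.2 r.2; lra.
- move=> u uC.
  have [|l1 hl1] := ca (fun n => (u n).1).
    move=> e /uC [N hN]; exists N => m n Nm Nn; have := hN m n Nm Nn.
    by have := bpos (u m).2 (u n).2; lra.
  have [|l2 hl2] := cb (fun n => (u n).2).
    move=> e /uC [N hN]; exists N => m n Nm Nn; have := hN m n Nm Nn.
    by have := apos (u m).1 (u n).1; lra.
  exists (l1, l2) => e e0 /=.
  have [N1 h1] := hl1 (e / 2)%R ltac:(lra); have [N2 h2] := hl2 (e / 2)%R ltac:(lra).
  exists (maxn N1 N2) => n; rewrite geq_max => /andP[/h1 + /h2]; lra.
- apply/seteqP; split => U /=.
    move=> /open_prodP oU p /oU [V [W [/oaE oV /obE oW /oV [e [e0 he]] /oW [f [f0 hf]] VW]]].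
    exists (Rmin e f); split; first exact: Rmin_glb_lt.
    move=> q hq; have := Rmin_l e f; have := Rmin_r e f.
    have := apos p.1 q.1; have := bpos p.2 q.2 => *.
    by apply: VW; split; [apply: he|apply: hf]; lra.
  move=> oU; apply/open_prodP => p /oU [e [e0 he]].
  exists [set x | (a p.1 x < e / 2)%R], [set y | (b p.2 y < e / 2)%R]; split.
  + by apply/oaE; exact: metric_ball_open.
  + by apply/obE; exact: metric_ball_open.
  + by rewrite /= (a0 _ _).2//; lra.
  + by rewrite /= (b0 _ _).2//; lra.
  + by move=> q [/= h1 h2]; apply: he; lra.
- exists (DA `*` DB); split.
    move/countable_injP: cDA => [f finj]; move/countable_injP: cDB => [g ginj].
    apply/countable_injP; exists (fun p => pickle (f p.1, g p.2)).
    move=> [x1 x2] [y1 y2]; rewrite !inE /= => -[x1D x2D] [y1D y2D].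
    move=> /(pcan_inj pickleK) [e1 e2].
    by congr pair; [apply: finj|apply: ginj] => //; rewrite inE.
  move=> U /open_prodP oU [p /oU [V [W [oV oW Vp Wp VW]]]].
  have [|x [Dx Vx]] := dDA V oV; first by exists p.1.
  have [|y [Dy Wy]] := dDB W oW; first by exists p.2.
  by exists (x, y); split => //; apply: VW.
Qed.

Definition is_least (P : nat -> Prop) (m : nat) : Prop :=
  P m /\ forall m', (m' < m)%N -> ~ P m'.

Lemma least_ex (P : nat -> Prop) : (exists m, P m) -> exists m, is_least P m.
Proof.
move=> [m Pm]; have ex : exists m, `[< P m >] by exists m; apply/asboolP.
exists (ex_minn ex); case: ex_minnP => k /asboolP Pk kmin; split => // k' k'k /asboolP /kmin.
by rewrite leqNgt k'k.
Qed.

Lemma is_least_uniq P m m' : is_least P m -> is_least P m' -> m = m'.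
Proof.
move=> [Pm hm] [Pm' hm']; case: (ltngtP m m') => // h; first by case: (hm' _ h).
by case: (hm _ h).
Qed.

Lemma Zsp_eq (X0 G : topologicalType) (F F' : Zsp X0 G) : proj1_sig F = proj1_sig F' -> F = F'.
Proof.
case: F F' => [F pF] [F' pF'] /= E; subst F'.
by congr exist; exact: Prop_irrelevance.
Qed.

Section Effros.
Variables (X0 G : topologicalType) (d : X0 * G -> X0 * G -> R) (B : nat -> set (X0 * G)).
Hypotheses (md : is_metric d) (cd : metric_complete d)
  (od : forall U : set (X0 * G), open U <-> metric_open d U)
  (B0 : B 0%N = setT) (Bo : forall n, open (B n))
  (Bb : forall x e, (0 < e)%R -> exists n, B n x /\ forall y, B n y -> (d x y < e)%R).

Definition meets (F : Zsp X0 G) (n : nat) : Prop := (proj1_sig F `&` B n) !=set0.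

(** With closures, the limit of points taken along a chain of refinements stays in every member; the
    diameter bound makes such points Cauchy. *)
Definition refines (n k m : nat) : Prop :=
  [/\ B m !=set0, closure (B m) `<=` B n &
      forall x y, B m x -> B m y -> (d x y < / INR k.+1)%R].

Definition witness (S : nat -> Prop) (n k m : nat) : Prop := S m /\ refines n k m.

Lemma base_open (U : set (X0 * G)) x : open U -> U x -> exists n, B n x /\ B n `<=` U.
Proof.
move=> /od oU /oU [e [e0 he]]; have [n [Bx hn]] := Bb x e0.
by exists n; split => // y /hn /he.
Qed.

Lemma refines_ex n k x : B n x -> exists m, B m x /\ refines n k m.
Proof.
have [dpos [d0 [dsym dtri]]] := md.
move=> Bnx; have [e [e0 he]] := (od _).1 (@Bo n) x Bnx.
have k0 := inv_pos k.
have [m [Bx hm]] := Bb x (Rmin_glb_lt (e / 2) (/ INR k.+1 / 2) 0 ltac:(lra) ltac:(lra)).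
exists m; split => //; split; first by exists x.
  move=> y; rewrite closureEonbhs => cy; apply: he.
  have [|z [Bz /= yz]] := cy _ [set z | (d y z < e / 2)%R] (fun z h => h).
    split; first by apply/od; exact: metric_ball_open.
    by rewrite /= (d0 _ _).2//; lra.
  have := hm z Bz; have := Rmin_l (e / 2) (/ INR k.+1 / 2).
  by have := dtri x z y; rewrite (dsym z y); lra.
move=> y z /hm h1 /hm h2; have := Rmin_r (e / 2) (/ INR k.+1 / 2).
by have := dtri y x z; rewrite (dsym y x); lra.
Qed.

(** Zero records that a basic set is missed, [m.+1] that [m] is the least witness. Storing witnesses
    makes the set of codes closed: a limit of the families [meets F] alone could lose its points.
    Leastness makes the code unique. *)
Definition is_code (S : nat -> Prop) (p : nat * nat) (v : nat) : Prop :=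
  (~ S p.1 /\ v = 0%N) \/
  (S p.1 /\ exists2 m, v = m.+1 & is_least (witness S p.1 p.2) m).

Lemma is_code_uniq S p v v' : is_code S p v -> is_code S p v' -> v = v'.
Proof.
case=> [[nS ->]|[Sp [m -> hm]]] [[nS' ->]|[Sp' [m' -> hm']]] //.
by rewrite (is_least_uniq hm hm').
Qed.

Lemma code_ex : exists code : Zsp X0 G -> nat * nat -> nat,
  forall F p, is_code (meets F) p (code F p).
Proof.
suff H F p : exists v, is_code (meets F) p v.
  have /choice [code hc] : forall F, exists f, forall p, is_code (meets F) p (f p).
    by move=> F; have [f hf] := choice (H F); exists f.
  by exists code.
have [Sp|nS] := pselect (meets F p.1); last by exists 0%N; left.
have [x [Fx Bx]] := Sp; have [m [Bm rm]] := refines_ex p.2 Bx.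
have [|k hk] := @least_ex (witness (meets F) p.1 p.2).
  by exists m; split => //; exists x.
by exists k.+1; right; split => //; exists k.
Qed.

(** The complement of a closed set is the union of the basic sets that it misses. *)
Lemma meets_inj (F F' : Zsp X0 G) : (forall n, meets F n <-> meets F' n) -> F = F'.
Proof.
have sub (K K' : Zsp X0 G) : (forall n, meets K n <-> meets K' n) ->
    proj1_sig K `<=` proj1_sig K'.
  move=> H x Kx; apply: contrapT => nK'x.
  have /(base_open (x := x)) : open (~` proj1_sig K').
    by apply: closed_openC; case: (proj2_sig K').
  case=> // n [Bx Bn]; have [|y [K'y By]] := (H n).1; first by exists x.
  exact: Bn y By K'y.
by move=> H; apply: Zsp_eq; apply/seteqP; split; apply: sub => // n; split => /H.
Qed.

(* A descending sequence of witnesses shrinks to a point of the closed set coded by [S]. *)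
Lemma decode (S : nat -> Prop) : S 0%N ->
  (forall n m, B m `<=` B n -> S m -> S n) ->
  (forall n k, S n -> exists m, witness S n k m) ->
  exists F, meets F = S.
Proof.
have [dpos [d0 [dsym dtri]]] := md.
move=> S0 Sup Sw; pose F := [set x | forall n, B n x -> S n].
have Fpt n : S n -> (F `&` B n) !=set0.
  move=> Sn.
  have /choice [nx hnx] : forall p : nat * nat, exists m, S p.1 -> witness S p.1 p.2 m.
    move=> [a k]; have [Sa|nS] := pselect (S a); last by exists 0%N.
    by have [m hm] := Sw a k Sa; exists m.
  pose w := fix w k := if k is k'.+1 then nx (w k', k') else n.
  have wS k : S (w k) by elim: k => //= k IH; have [] := hnx (w k, k) IH.
  have wr k : refines (w k) k (w k.+1) by have [] := hnx (w k, k) (wS k).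
  have wsub j k : (j <= k)%N -> B (w k) `<=` B (w j).
    elim: k => [|k IH]; first by rewrite leqn0 => /eqP ->.
    rewrite leq_eqVlt => /orP[/eqP->//|/IH H].
    apply: subset_trans H; have [_ h _] := wr k.
    by apply: subset_trans h; exact: subset_closure.
  have /choice [u hu] : forall k, exists x, B (w k.+1) x by move=> k; have [] := wr k.
  have uB j k : (j <= k)%N -> B (w j.+1) (u k) by move=> jk; apply: (wsub _ k.+1 _ _ (hu k)).
  have [|x hx] := cd (u := u).
    move=> e /inv_lt [N hN]; exists N => m k Nm Nk.
    have [_ _ h] := wr N; have := h _ _ (uB _ _ Nm) (uB _ _ Nk); lra.
  have Bx k : B (w k) x.
    have [_ h _] := wr k; apply: h; rewrite closureEonbhs => A V hA [/od oV Vx].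
    have [e [e0 he]] := oV _ Vx; have [N hN] := hx e e0.
    exists (u (maxn N k)); split; first by apply/hA/uB; exact: leq_maxr.
    by apply: he; rewrite dsym; apply: hN; exact: leq_maxl.
  exists x; split; last exact: (Bx 0%N).
  (* Any [B m] around the limit [x] contains a late member of the chain, so upward closure gives
     [S m]. *)
  move=> m Bmx; have [e [e0 he]] := (od _).1 (@Bo m) x Bmx.
  have [N hN] := inv_lt e0.
  apply: (Sup _ (w N.+1)) => // y By; apply: he.
  have [_ _ h] := wr N; have := h x y (Bx _) By; lra.
have cF : closed F.
  rewrite (_ : F = ~` \bigcup_(n in [set n | ~ S n]) B n).
    by apply: open_closedC; apply: bigcup_open => n _; exact: (@Bo n).
  apply/seteqP; split => x /=; first by move=> Fx [n nS /Fx].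
  by move=> h n Bx; apply: contrapT => nS; apply: h; exists n.
have F0 : F !=set0 by have [x []] := Fpt _ S0; exists x.
exists (exist _ F (conj cF F0)); apply/funext => n; apply/propext; split.
  by move=> [x [/= Fx]]; exact: Fx.
exact: Fpt.
Qed.

Lemma meets0 F : meets F 0%N.
Proof. by rewrite /meets B0 setIT; case: (proj2_sig F). Qed.

Lemma meets_up F n m : B m `<=` B n -> meets F m -> meets F n.
Proof. by move=> h [x [Fx /h Bx]]; exists x. Qed.

Lemma effros_meets n : effros [set F | meets F n].
Proof. by apply: sub_sigma_algebra; exists (B n). Qed.

(** The Polish topology is the one that [c] pulls back from the space of sequences. Most of the
    proof shows that a limit of codes is a code: each defining condition involves finitely many
    positions, where the limit agrees with an actual code. *)
Lemma effros_standard_base : standard_borel (@effros X0 G).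
Proof.
have [code hcode] := code_ex.
pose num F j := if unpickle j is Some p then code F p else 0%N.
have numE F p : num F (pickle p) = code F p by rewrite /num pickleK.
pose c F j := INR (num F j).
have meetsE F n k : meets F n <-> code F (n, k) <> 0%N.
  by case: (hcode F (n, k)) => -[/= Sn]; [move=> ->|case=> m ->].
have cinj : injective c.
  move=> F F' E; apply: meets_inj => n.
  have : c F (pickle (n, 0%N)) = c F' (pickle (n, 0%N)) by rewrite E.
  by rewrite /c !numE => /INR_eq e; rewrite !(meetsE _ n 0%N) e.
have cclosed (z : nat -> R) : (forall N e, (0 < e)%R -> exists F,
    forall i, (i < N)%N -> (Rabs (c F i - z i) < e)%R) -> exists F, c F = z.
  move=> H.
  have /choice [zn hzn] : forall i, exists k, z i = INR k.
    move=> i.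
    have near e : (0 < e)%R -> exists k, (Rabs (INR k - z i) < e)%R.
      by move=> e0; have [F hF] := H i.+1 e e0; exists (num F i); apply: hF.
    have [k hk] := near (1 / 2)%R ltac:(lra).
    (* A code value strictly closer to [z i] than [k] is within 1 of [k], hence equal to [k], which
       is absurd. *)
    exists k; apply: contrapT => nz.
    have p0 : (0 < Rabs (INR k - z i))%R.
      by apply: Rabs_pos_lt => h; apply: nz; lra.
    have [k' hk'] := near _ p0.
    have : (Rabs (INR k - INR k') < 1)%R.
      have := Rabs_triang (INR k - z i) (z i - INR k').
      rewrite (Rabs_minus_sym (z i)).
      have -> : (INR k - z i + (z i - INR k') = INR k - INR k')%R by lra.
      lra.
    move=> /Rabs_def2 [h1 h2].
    have kk : k = k'.
      apply/eqP; rewrite eqn_leq; apply/andP; split.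
        rewrite -ltnS; apply/ltP/INR_lt; rewrite S_INR; lra.
      by rewrite -ltnS; apply/ltP/INR_lt; rewrite S_INR; lra.
    by rewrite kk in hk'; rewrite kk in nz hk'; lra.
  have agree N : exists F, forall i, (i < N)%N -> num F i = zn i.
    have [F hF] := H N 1%R ltac:(lra); exists F => i /hF.
    rewrite /c hzn => /Rabs_def2 [h1 h2].
    apply/eqP; rewrite eqn_leq; apply/andP; split.
      by rewrite -ltnS; apply/ltP/INR_lt; rewrite S_INR; lra.
    by rewrite -ltnS; apply/ltP/INR_lt; rewrite S_INR; lra.
  pose zp (p : nat * nat) := zn (pickle p).
  have agreep (s : seq (nat * nat)) : exists F, forall p, p \in s -> code F p = zp p.
    have [F hF] := agree (\max_(p <- s) pickle p).+1; exists F => p ps.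
    rewrite -numE; apply: hF; rewrite ltnS.
    by apply: (@leq_bigmax_seq _ s xpredT pickle).
  pose S n := zp (n, 0%N) <> 0%N.
  have zcode p : is_code S p (zp p).
    case: p => n k.
    (* These positions decide [is_code] at [(n, k)]: if the value is [m.+1], both the witness [m]
       and its smaller competitors lie below it. *)
    have [F hF] := agreep ((n, k) :: (n, 0%N) :: [seq (m, 0%N) | m <- iota 0 (zp (n, k))]).
    have SF : S n <-> meets F n.
      by rewrite /S (meetsE F n 0%N) hF// !inE eqxx orbT.
    have Sm m : (m < zp (n, k))%N -> (S m <-> meets F m).
      move=> mz; rewrite /S (meetsE F m 0%N) hF// !inE; apply/orP; right.
      by apply/orP; right; apply: map_f; rewrite mem_iota.
    have := hcode F (n, k); rewrite hF ?inE ?eqxx// => -[[/= nS e]|[/= Sn [m e [hm hmin]]]].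
      by left; rewrite SF.
    right; split; first exact/SF.
    exists m => //; split; first by case: hm => hm1 hm2; split => //; apply/Sm; rewrite ?e.
    move=> m' m'm [Sm' r]; apply: (hmin m' m'm); split => //.
    by apply/Sm => //; rewrite e ltnS ltnW.
  have [F hF] : exists F, meets F = S.
    apply: decode.
    - have [F hF] := agreep [:: (0, 0)%N].
      by rewrite /S -hF ?inE//; apply/meetsE; exact: meets0.
    - move=> n m Bmn; have [F hF] := agreep [:: (n, 0%N); (m, 0%N)].
      rewrite /S -!hF ?inE ?eqxx ?orbT// -!meetsE; exact: meets_up.
    - move=> n k Sn; case: (zcode (n, k)) => [[]//|[_ [m _ [hm _]]]].
      by exists m.
  exists F; apply/funext => j; rewrite hzn /c; congr INR.
  case Ej: (unpickle j : option (nat * nat)) => [p|]; last first.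
    by have [F' hF'] := agree j.+1; rewrite -hF'// /num Ej.
  (* Since [j] may differ from [pickle p], agreement is taken at both positions. *)
  have [F' hF'] := agree (maxn j (pickle p)).+1.
  rewrite -hF' ?ltnS ?leq_maxl// {2}/num Ej -numE hF' ?ltnS ?leq_maxr//.
  by rewrite /num Ej; apply: (@is_code_uniq S p) => //; rewrite -hF.
exists (metric_open (cdist c)); split; first exact: coded_polish.
apply/seteqP; split; last first.
  (* Open sets of the code topology are Effros sets: each event [num F j = v] is a countable Boolean
     combination of conditions [meets F n]. *)
  apply: smallest_sub; first exact: salg_gen.
  have HS := @salg_gen (Zsp X0 G) [set W | exists U : set (X0 * G), open U /\
                 W = [set F : Zsp X0 G | (proj1_sig F `&` U) !=set0]].
  suff Hc j r : effros [set F | (c F j < r)%R].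
    by move=> U oU; exact: (coded_meas (f := idfun) HS Hc oU).
  rewrite (_ : mkset _ = [set F | exists v : nat, (INR v < r)%R /\ num F j = v]); last first.
    by apply/seteqP; split => F /=; [exists (num F j)|case=> v [h e]; rewrite /c e].
  apply: (salg_ex HS) => v; apply: (salg_and HS); first exact: (salg_cst HS).
  rewrite /num; case: (unpickle j) => [p|]; last exact: (salg_cst HS).
  rewrite (_ : (fun F => _) = [set F | is_code (meets F) p v]); last first.
    apply/seteqP; split => F /=; first by move=> <-.
    exact: is_code_uniq.
  apply: (salg_or HS).
    apply: (salg_and HS); last exact: (salg_cst HS).
    exact: (salgC HS (effros_meets _)).
  apply: (salg_and HS); first exact: effros_meets.
  rewrite (_ : (fun F => _) = [set F | exists m, v = m.+1 /\ is_least (witness (meets F) p.1 p.2) m]).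
    apply: (salg_ex HS) => m; apply: (salg_and HS); first exact: (salg_cst HS).
    have Hw k : effros [set F | witness (meets F) p.1 p.2 k].
      by apply: (salg_and HS); [exact: effros_meets|exact: (salg_cst HS)].
    apply: (salg_and HS); first exact: Hw.
    apply: (salg_all HS) => m'; apply: (salg_imp HS); exact: (salgC HS (Hw _)).
  by apply/seteqP; split => F /= [m]; [|case]; exists m.
apply: smallest_sub; first exact: salg_gen.
move=> _ [U [oU ->]].
have HS := salg_gen (metric_open (cdist c)).
rewrite (_ : mkset _ = [set F | exists n, B n `<=` U /\ meets F n]); last first.
  apply/seteqP; split => F /=.
    by move=> [x [Fx /(base_open oU) [n [Bx BU]]]]; exists n; split => //; exists x.
  by move=> [n [BU [x [Fx /BU Ux]]]]; exists x.
apply: (salg_ex HS) => n; apply: (salg_and HS); first exact: (salg_cst HS).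
apply: sub_sigma_algebra; apply/cdist_openP => F Fn.
(* The code of [F] at [(n, 0)] is at least 1, so a code within distance 1 of it there is non-zero as
   well. *)
exists (pickle (n, 0%N)).+1, 1%R; split; first lra.
move=> F' /(_ _ (ltnSn _)); rewrite /c !numE.
move/meetsE: (Fn) => /(_ 0%N) h1 h2; apply/(meetsE _ _ 0%N) => h3.
move: h2; rewrite h3 -[INR 0]/0%R.
have /leP /le_INR : (1 <= code F (n, 0))%N by rewrite lt0n; apply/eqP.
rewrite -[INR 1]/1%R; move=> h4 /Rabs_def2; lra.
Qed.
End Effros.

Lemma effros_standard (X0 G : topologicalType) :
  polish_top [set U : set X0 | open U] -> polish_top [set U : set G | open U] ->
  standard_borel (@effros X0 G).
Proof.
move=> pX pG; have [d [md cd od [B [B0 Bo Bb]]]] := polish_base (polish_prod pX pG).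
by apply: (effros_standard_base md cd _ B0 Bo Bb) => U; rewrite -od.
Qed.

(** * Baire category *)

Section Category.
Variable G : topologicalType.
Implicit Types A U V W : set G.

Definition meager A : Prop := exists F : nat -> set G,
  (forall n, closed (F n) /\ forall U, open U -> U `<=` F n -> U = set0) /\
  A `<=` \bigcup_n F n.

Lemma meager_sub A A' : A `<=` A' -> meager A' -> meager A.
Proof. by move=> AA' [F [hF A'F]]; exists F; split => //; exact: subset_trans A'F. Qed.

Lemma meager_bigcup (A : nat -> set G) : (forall n, meager (A n)) -> meager (\bigcup_n A n).
Proof.
move=> /choice [F hF].
exists (fun j => if unpickle j is Some p then F p.1 p.2 else set0); split.
  move=> j; case: (unpickle j) => [[n m]|]; first by have [+ _] := hF n; apply.
  by split; [exact: closed0|move=> U _; rewrite subset0].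
move=> x [n _ Anx]; have [_ /(_ _ Anx) [m _ Fx]] := hF n.
by exists (pickle (n, m)) => //; rewrite pickleK.
Qed.

Lemma meager_setU A A' : meager A -> meager A' -> meager (A `|` A').
Proof.
move=> mA mA'; apply: (@meager_sub _ (\bigcup_(n : nat) (if n is 0 then A else A'))).
  by move=> x [Ax|Ax]; [exists 0%N|exists 1%N].
by apply: meager_bigcup => -[|n].
Qed.

Lemma meager0 : meager set0.
Proof.
exists (fun=> set0); split => [_|x []].
by split; [exact: closed0|move=> U _; rewrite subset0].
Qed.

(** Nested closed balls inside [U], the next one always avoiding [F k], shrink to a point by
    completeness; the cover [F] misses that point. *)
Lemma baire U : polish_top [set U : set G | open U] -> open U -> meager U -> U = set0.
Proof.
move=> [d [md [cd [od _]]]] oU [F [hF UF]].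
have odE V : open V <-> metric_open d V by rewrite -od.
have [dpos [d0 [dsym dtri]]] := md.
have oball c r : open [set y | (d c y < r)%R] by apply/odE; exact: metric_ball_open.
apply/seteqP; split => // x Ux.
have [r0 [r0p hr0]] := (odE U).1 oU x Ux.
(* Positivity of the radius is a premise, so that [choice] yields a step function defined on all
   pairs. *)
pose good (k : nat) (p q : G * R) := (0 < p.2)%R ->
  [/\ (0 < q.2)%R, (q.2 <= / INR k.+1)%R,
      forall y, (d q.1 y <= q.2)%R -> (d p.1 y < p.2)%R &
      forall y, (d q.1 y <= q.2)%R -> ~ F k y].
have /choice [next hnext] : forall s : nat * (G * R), exists q, good s.1 s.2 q.
  move=> [k [c r]]; have [r_pos|nr] := pselect (0 < r)%R; last by exists (c, r).
  have [cF nF] := hF k.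
  have [y [cy nFy]] : exists y, (d c y < r)%R /\ ~ F k y.
    apply: contrapT => H; have : [set y | (d c y < r)%R] = set0.
      by apply: nF => // y yc; apply: contrapT => nFy; apply: H; exists y.
    by move=> /seteqP [/(_ c) /= + _]; apply; rewrite (d0 _ _).2.
  have [e [e0 he]] := (odE _).1 (closed_openC cF) y nFy.
  set s := Rmin (e / 2) (Rmin ((r - d c y) / 2) (/ INR k.+1)).
  have kp := inv_pos k.
  have s1 : (s <= e / 2)%R by exact: Rmin_l.
  have s2 : (s <= (r - d c y) / 2)%R by apply: Rle_trans (Rmin_r _ _) (Rmin_l _ _).
  have s3 : (s <= / INR k.+1)%R by apply: Rle_trans (Rmin_r _ _) (Rmin_r _ _).
  exists (y, s) => _ /=; split => //.
  - by apply: Rmin_glb_lt; [lra|apply: Rmin_glb_lt; lra].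
  - by move=> z hz; have := dtri c y z; lra.
  - by move=> z hz; apply: he; lra.
pose b := fix b k := if k is k'.+1 then next (k', b k') else (x, (r0 / 2)%R).
have bp k : (0 < (b k).2)%R by elim: k => [|k IH] /=; [lra|have [] := hnext (k, b k) IH].
have bn k : good k (b k) (b k.+1) by exact: hnext (k, b k).
have bsub j k y : (j <= k)%N -> (d (b k).1 y <= (b k).2)%R -> (d (b j).1 y <= (b j).2)%R.
  elim: k => [|k IH]; first by rewrite leqn0 => /eqP ->.
  rewrite leq_eqVlt => /orP[/eqP->//|/IH H] h; apply: H.
  by have [_ _ /(_ _ h) + _] := bn k (bp k); lra.
have bc k : (d (b k).1 (b k).1 <= (b k).2)%R by rewrite (d0 _ _).2//; have := bp k; lra.
have [|l hl] := cd (fun k => (b k).1).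
  move=> e e0; have [N hN] : exists n : nat, (/ INR n.+1 < e / 2)%R by apply: inv_lt; lra.
  exists N.+1 => m n Nm Nn.
  have h1 := bsub _ _ _ Nm (bc m); have h2 := bsub _ _ _ Nn (bc n).
  have [_ h3 _ _] := bn N (bp N).
  have := dtri (b m).1 (b N.+1).1 (b n).1; rewrite (dsym (b m).1 (b N.+1).1); lra.
have lb k : (d (b k).1 l <= (b k).2)%R.
  apply: le_epsilon => e e0; have [N hN] := hl e e0.
  have h1 := hN (maxn N k) (leq_maxl _ _).
  have h2 := bsub _ _ _ (leq_maxr N k) (bc _).
  by have := dtri (b k).1 (b (maxn N k)).1 l; lra.
have [n _ Fl] : (\bigcup_n F n) l.
  by apply: UF; apply: hr0; have := lb 0%N; rewrite /=; lra.
by have [_ _ _ /(_ _ (lb _)) +] := bn n (bp n); apply.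
Qed.

(** * The Baire property and the category quantifier *)

Definition baire_property A : Prop :=
  exists O, [/\ open O, meager (A `\` O) & meager (O `\` A)].

Lemma borel_baire_property A : borel_sets A -> baire_property A.
Proof.
apply: salg_ind.
- by move=> U oU; exists U; rewrite setDv; split => //; exact: meager0.
- move=> {}A [O [oO m1 m2]]; exists (~` O)°; split; first exact: open_interior.
  + apply: (@meager_sub _ ((O `\` A) `|` (closure O `\` O))).
      move=> x [nAx nint]; have [Ox|nOx] := pselect (O x); [by left|right].
      by split => //; apply: contrapT => nc; apply: nint; rewrite interiorC.
    apply: meager_setU => //; exists (fun=> closure O `\` O); split; last by move=> x; exists 0%N.
    move=> _; split.
      by rewrite setDE; apply: closedI; [exact: closed_closure|exact: open_closedC].
    move=> U oU UO; apply/seteqP; split => // x Ux.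
    have [cx nx] := UO x Ux.
    have [y [Oy Uy]] := cx U (open_nbhs_nbhs (conj oU Ux)).
    by have [_] := UO y Uy; apply.
  + by apply: meager_sub m1 => x [/interior_subset nOx nnA]; split => //; apply: contrapT.
- move=> A' /choice [O hO]; exists (\bigcup_n O n); split.
  + by apply: bigcup_open => n _; have [] := hO n.
  + apply: (@meager_sub _ (\bigcup_n (A' n `\` O n))).
      by move=> x [[n _ Ax] nO]; exists n => //; split => // Ox; apply: nO; exists n.
    by apply: meager_bigcup => n; have [] := hO n.
  + apply: (@meager_sub _ (\bigcup_n (O n `\` A' n))).
      by move=> x [[n _ Ox] nA]; exists n => //; split => // Ax; apply: nA; exists n.
    by apply: meager_bigcup => n; have [] := hO n.
- by left; exists setT; exact: openT.
Qed.

(** If [O] is open and equals [A] up to a meager set, then [O] meets [W], and the intersection is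
    the required [V]. *)
Lemma nonmeager_comeager A W : borel_sets A -> open W -> ~ meager (A `&` W) ->
  exists V, [/\ open V, V !=set0, V `<=` W & meager (V `\` A)].
Proof.
move=> /borel_baire_property [O [oO m1 m2]] oW nm.
exists (O `&` W); split; first exact: openI.
- apply: contrapT => /set0P/negP/negPn/eqP E; apply: nm; apply: meager_sub m1.
  move=> x [Ax Wx]; split => // Ox.
  by have : (O `&` W) x by []; rewrite E.
- by move=> x [].
- by apply: meager_sub m2 => x [[]].
Qed.

End Category.

(* Montgomery-Novikov: the category quantifier preserves Borel sets. *)
Lemma section_meager_borel (G : topologicalType) (X : Type) (S : set (set X))
  (B : nat -> set G) :
  polish_top [set U : set G | open U] -> sigma_algebra setT S ->
  (forall n, open (B n)) ->
  (forall (U : set G) x, open U -> U x -> exists n, B n x /\ B n `<=` U) ->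
  forall C, prod_sigma (@borel_sets G) S C ->
    (forall x, borel_sets [set g | C (g, x)]) /\
    (forall W, open W -> S [set x | meager ([set g | C (g, x)] `&` W)]).
Proof.
move=> pG HS Bo Bb.
have HB : sigma_algebra setT (@borel_sets G) by exact: salg_gen.
apply: salg_ind.
- move=> _ [U [V [bU [SV ->]]]]; split => [x|W oW].
    rewrite (_ : mkset _ = [set g | U g /\ V x]).
      by apply: (salg_and HB) => //; exact: (salg_cst HB).
    by apply/seteqP; split.
  rewrite (_ : mkset _ = [set x | ~ V x \/ meager (U `&` W)]).
    by apply: (salg_or HS); [exact: (salgC HS)|exact: (salg_cst HS)].
  apply/seteqP; split => x /=.
    move=> h; have [Vx|nVx] := pselect (V x); [right|by left].
    by apply: meager_sub h => g [Ug Wg].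
  by case=> [nVx|]; apply: meager_sub; [|apply: (@meager0 G)|] => g [[]].
- move=> C [C1 C2]; split => [x|W oW]; first exact: (salgC HB (C1 x)).
  (* The complement is meager in [W] exactly when [C] is meager in no non-empty basic subset of [W].
     One direction is the Baire theorem, the other localizes a non-meager Borel set; quantifying
     over basic sets keeps the condition countable. *)
  rewrite (_ : mkset _ = [set x | ~ exists n, (B n !=set0 /\ B n `<=` W) /\
      meager ([set g | C (g, x)] `&` B n)]).
    apply: (salgC HS); apply: (salg_ex HS) => n; apply: (salg_and HS); last exact: C2.
    exact: (salg_cst HS).
  apply/seteqP; split => x /=.
    move=> h [n [[[y By] BW] m]].
    have : B n = set0.
      apply: baire => //; apply: meager_sub (meager_setU h m) => g Bg.
      by have [Cg|nCg] := pselect (C (g, x)); [right|left; split => //; exact: BW].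
    by move=> E; rewrite E in By.
  move=> H; apply: contrapT => nm; apply: H.
  have [V [oV [y Vy] VW mV]] := nonmeager_comeager (salgC HB (C1 x)) oW nm.
  have [n [By BV]] := Bb V y oV Vy.
  exists n; split; first by split; [exists y|exact: subset_trans VW].
  by apply: meager_sub mV => g [Cg /BV Vg]; split => // /(_ Cg).
- move=> C HC; split => [x|W oW].
    rewrite (_ : mkset _ = [set g | exists n, C n (g, x)]).
      by apply: (salg_ex HB) => n; have [h _] := HC n; exact: h.
    by apply/seteqP; split => g /= [n]; exists n.
  rewrite (_ : mkset _ = [set x | forall n, meager ([set g | C n (g, x)] `&` W)]).
    by apply: (salg_all HS) => n; have [_ h] := HC n; exact: h.
  apply/seteqP; split => x /=.
    by move=> h n; apply: meager_sub h => g [Cg Wg]; split => //; exists n.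
  move=> /meager_bigcup; apply: meager_sub => g [[n _ Cg] Wg].
  by exists n.
- left; exists (set0 `*` set0), set0, set0; split; first by case: HB.
  by split => //; case: HS.
Qed.

(** * Polish groups *)

Section TopologicalGroup.
Variables (G : topologicalType) (mul : G -> G -> G) (inv : G -> G) (one : G).
Hypothesis HG : polish_group mul inv one.

Local Notation "x ** y" := (mul x y) (at level 40, left associativity).

Lemma gmulA a b c : a ** (b ** c) = a ** b ** c.
Proof. by case: HG => -[]. Qed.
Lemma gmul1 a : one ** a = a.
Proof. by case: HG => -[_ []]. Qed.
Lemma gmulr1 a : a ** one = a.
Proof. by case: HG => -[_ [_ []]]. Qed.
Lemma gmulV a : inv a ** a = one.
Proof. by case: HG => -[_ [_ [_ []]]]. Qed.
Lemma gmulrV a : a ** inv a = one.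
Proof. by case: HG => -[_ [_ [_ []]]]. Qed.
Lemma gmulKV a b : a ** (inv a ** b) = b.
Proof. by rewrite gmulA gmulrV gmul1. Qed.
Lemma gmulVK a b : inv a ** (a ** b) = b.
Proof. by rewrite gmulA gmulV gmul1. Qed.
Lemma gmulrK a b : a ** b ** inv b = a.
Proof. by rewrite -gmulA gmulrV gmulr1. Qed.
Lemma gmulrKV a b : a ** inv b ** b = a.
Proof. by rewrite -gmulA gmulV gmulr1. Qed.
Lemma ginv_uniq a b : a ** b = one -> inv a = b.
Proof. by move=> h; rewrite -[LHS]gmulr1 -h gmulVK. Qed.
Lemma ginvK a : inv (inv a) = a.
Proof. by apply: ginv_uniq; rewrite gmulV. Qed.
Lemma ginvM a b : inv (a ** b) = inv b ** inv a.
Proof. by apply: ginv_uniq; rewrite gmulA gmulrK gmulrV. Qed.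
Lemma ginv1 : inv one = one.
Proof. by apply: ginv_uniq; rewrite gmul1. Qed.

Lemma gdiv_open (U : set G) a b : open U -> U (a ** inv b) ->
  exists V W, [/\ open V, open W, V a, W b & forall v w, V v -> W w -> U (v ** inv w)].
Proof.
case: HG => _ [/continuousP ct _] oU Uab.
have [V [W [oV oW Va Wb VW]]] := (open_prodP _).1 (ct U oU) (a, b) Uab.
by exists V, W; split => // v w Vv Ww; exact: (VW (v, w)).
Qed.

Lemma open_of_nbhs_sets (U : set G) :
  (forall x, U x -> exists V, [/\ open V, V x & V `<=` U]) -> open U.
Proof.
move=> H; rewrite openE => x /H [V [oV Vx VU]].
by rewrite /interior; apply: (filterS VU); exact: open_nbhs_nbhs.
Qed.

Lemma open_inv (U : set G) : open U -> open [set g | U (inv g)].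
Proof.
move=> oU; apply: open_of_nbhs_sets => b /= Ub.
have [|V [W [oV oW V1 Wb H]]] := @gdiv_open U one b oU; first by rewrite gmul1.
by exists W; split => // w Ww; rewrite /= -[inv w]gmul1; exact: H.
Qed.

Lemma gmul_open (U : set G) a b : open U -> U (a ** b) ->
  exists V W, [/\ open V, open W, V a, W b & forall v w, V v -> W w -> U (v ** w)].
Proof.
move=> oU Uab; have [|V [W [oV oW Va Wb H]]] := @gdiv_open U a (inv b) oU.
  by rewrite ginvK.
exists V, [set w | W (inv w)]; split => //; first exact: open_inv.
by move=> v w Vv Ww; rewrite -[w]ginvK; exact: H.
Qed.

Lemma open_lmul (U : set G) a : open U -> open [set g | U (a ** g)].
Proof.
move=> oU; apply: open_of_nbhs_sets => b /= Ub.
have [V [W [oV oW Va Wb H]]] := gmul_open oU Ub.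
by exists W; split => // w Ww; exact: H.
Qed.

Lemma open_rmul (U : set G) a : open U -> open [set g | U (g ** a)].
Proof.
move=> oU; apply: open_of_nbhs_sets => b /= Ub.
have [V [W [oV oW Vb Wa H]]] := gmul_open oU Ub.
by exists V; split => // v Vv; exact: H.
Qed.

Lemma meager_rmul (A : set G) a : meager A -> meager [set g | A (g ** a)].
Proof.
move=> [F [hF AF]]; exists (fun n => [set g | F n (g ** a)]); split; last first.
  by move=> g /AF [n _ Fg]; exists n.
move=> n; have [cF nF] := hF n; split.
  rewrite (_ : mkset _ = ~` [set g | (~` F n) (g ** a)]).
    by apply/open_closedC/open_rmul/closed_openC.
  by apply/seteqP; split => g /=; [move=> h; apply|exact: contrapT].
move=> U oU UF; apply/seteqP; split => // x Ux.
have E : [set g | U (g ** inv a)] = set0.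
  apply: nF; first exact: open_rmul.
  by move=> g /UF /=; rewrite gmulrKV.
by have : (set0 : set G) (x ** a) by rewrite -E /= gmulrK.
Qed.

(** * Neighbourhood chains at the identity and weighted products *)

Definition nbhd_chain (V : nat -> set G) : Prop :=
  [/\ forall i, open (V i), forall i, V i one, forall i g, V i g -> V i (inv g),
      forall i a b c, V i.+1 a -> V i.+1 b -> V i.+1 c -> V i (a ** b ** c) &
      forall U, open U -> U one -> exists i, V i `<=` U].

(** Two uses of continuity of multiplication at the identity handle triple products, intersecting
    with the inverse gives symmetry, and a basic set of radius [/ INR i.+1] makes the chain a
    base. *)
Lemma nbhd_chain_ex : exists V, nbhd_chain V.
Proof.
have [_ [_ pG]] := HG.
have [d [md cd od [B [B0 Bo Bb]]]] := polish_base pG.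
have odE U : open U <-> metric_open d U by rewrite -od.
pose good (i : nat) (U V : set G) := open U -> U one ->
  [/\ open V, V one, forall g, V g -> V (inv g),
      forall a b c, V a -> V b -> V c -> U (a ** b ** c) &
      forall g, V g -> (d one g < / INR i.+1)%R].
have /choice [next hnext] : forall s : nat * set G, exists V, good s.1 s.2 V.
  move=> [i U]; have [[oU U1]|h] := pselect (open U /\ U one); last first.
    by exists U => oU U1; case: h.
  have [|W [V3 [oW oV3 W1 V31 H]]] := @gmul_open U one one oU; first by rewrite gmul1.
  have [|V1 [V2 [oV1 oV2 V11 V21 H']]] := @gmul_open W one one oW; first by rewrite gmul1.
  have [n [Bn1 Bn]] := Bb one _ (inv_pos i).
  pose V' := V1 `&` V2 `&` V3 `&` B n.
  have oV' : open V' by repeat apply: openI => //; exact: Bo.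
  have V'1 : V' one by [].
  exists (V' `&` [set g | V' (inv g)]) => _ _; split.
  - by apply: openI => //; exact: open_inv.
  - by split => //=; rewrite ginv1.
  - by move=> g [h1 h2]; split => //=; rewrite ginvK.
  - by move=> a b c [[[[]]]] ? ? ? ? _ [[[[]]]] ? ? ? ? _ [[[[]]]] ? ? ? ? _; apply: H => //; exact: H'.
  - by move=> g [[_ /Bn]].
pose V := fix V i := if i is j.+1 then next (i, V j) else next (0%N, setT).
have V0 : good 0%N setT (V 0%N) by exact: (hnext (0%N, setT)).
have Vs i : good i.+1 (V i) (V i.+1) by exact: (hnext (i.+1, V i)).
have Vo i : open (V i) /\ V i one.
  elim: i => [|i [IH1 IH2]]; first by have [] := V0 openT I.
  by have [] := Vs i IH1 IH2.
exists V; split.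
- by move=> i; have [] := Vo i.
- by move=> i; have [] := Vo i.
- by move=> [|i]; [have [] := V0 openT I|have [h1 h2] := Vo i; have [] := Vs i h1 h2].
- by move=> i; have [h1 h2] := Vo i; have [] := Vs i h1 h2.
- move=> U /odE oU /oU [e [e0 he]]; have [i hi] := inv_lt e0.
  exists i.+1 => g Vg; apply: he; have [h1 h2] := Vo i.
  have [_ _ _ _ /(_ _ Vg)] := Vs i h1 h2.
  by have := inv_le (leqnSn i); lra.
Qed.

Section Chains.
Variable V : nat -> set G.
Hypothesis HV : nbhd_chain V.

Fixpoint weight (l : seq nat) : R := if l is i :: l' then ((/ 2) ^ i + weight l')%R else 0%R.

Fixpoint prods (l : seq nat) : set G :=
  if l is i :: l' then [set g | exists a b, [/\ V i a, prods l' b & g = a ** b]]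
  else [set one].

Lemma half_pos i : (0 < (/ 2) ^ i)%R.
Proof. by apply: pow_lt; lra. Qed.

Lemma half_small e : (0 < e)%R -> exists i, ((/ 2) ^ i < e)%R.
Proof.
move=> e0; have [|N hN] := pow_lt_1_zero (/ 2) _ e e0.
  by rewrite Rabs_pos_eq; lra.
exists N; have := hN N (le_n _); rewrite Rabs_pos_eq//.
by have := half_pos N; lra.
Qed.

Lemma half_lt_inv i j : ((/ 2) ^ i < (/ 2) ^ j)%R -> (j < i)%N.
Proof.
move=> h; rewrite ltnNge; apply/negP => ij; move: h.
rewrite -(subnK ij); elim: (j - i)%N => [|k IHk]; first by rewrite add0n; lra.
by rewrite addSn /= => h; apply: IHk; have := half_pos (k + i); lra.
Qed.

Lemma weight_ge0 l : (0 <= weight l)%R.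
Proof. by elim: l => /= [|i l]; [lra|have := half_pos i; lra]. Qed.

Lemma weight_cat l l' : weight (l ++ l') = (weight l + weight l')%R.
Proof. by elim: l => /= [|i l ->]; lra. Qed.

Lemma prods_cat l l' g : prods (l ++ l') g <->
  exists a b, [/\ prods l a, prods l' b & g = a ** b].
Proof.
elim: l g => [|i l IH] g /=; split.
- by move=> h; exists one, g; rewrite gmul1.
- by move=> [_ [b [-> h ->]]]; rewrite gmul1.
- move=> [a [b [Va /IH [a' [b' [h1 h2 ->]]] ->]]].
  by exists (a ** a'), b'; rewrite gmulA; split => //; exists a, a'.
- move=> [_ [b [[a [a' [Va h ->]]] h2 ->]]].
  by exists a, (a' ** b); rewrite gmulA; split => //; apply/IH; exists a', b.
Qed.

(** Right translates of the first factor cover the product. The word is non-empty because the empty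
    product is the singleton of [one]. *)
Lemma prods_open i l : open (prods (i :: l)).
Proof.
have [Vo _ _ _ _] := HV.
apply: open_of_nbhs_sets => g /= [a [b [Va hb ->]]].
exists [set x | V i (x ** inv b)]; split; first exact: open_rmul.
  by rewrite /= gmulrK.
by move=> x /= Vx; exists (x ** inv b), b; rewrite gmulrKV.
Qed.

(** The cut falls at the first letter whose tail weighs less than [h]. As long as the tail weighs at
    least [h], the bound on the total keeps the prefix, [s] included, below [h]. *)
Lemma weight_split h s l : (0 <= s)%R -> (s < h)%R -> (s + weight l < 2 * h)%R -> l <> [::] ->
  exists l1 i l2, [/\ l = l1 ++ i :: l2, (s + weight l1 < h)%R & (weight l2 < h)%R].
Proof.
elim: l s => // i l IH s s0 sh /= sl _; have := half_pos i => hi.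
have [lh|lh] := Rlt_le_dec (weight l) h.
  by exists [::], i, l; split => //=; lra.
have [|||+|l1 [j [l2 [-> h1 h2]]]] := IH (s + (/ 2) ^ i)%R; [lra|lra|lra| |].
  by move=> l0; rewrite l0 /= in lh; lra.
by exists (i :: l1), j, l2; split => //=; lra.
Qed.

Lemma nbhd_mono i j g : (i <= j)%N -> V j g -> V i g.
Proof.
have [_ V1 _ V3 _] := HV.
move=> ij; rewrite -(subnK ij); elim: (j - i)%N => [|k IH] //.
rewrite addSn => Vg; apply: IH; rewrite -[g]gmul1 -[one ** g]gmulr1.
exact: V3.
Qed.

(* The Birkhoff-Kakutani estimate. *)
Lemma prods_small l n : (weight l < (/ 2) ^ n)%R -> prods l `<=` V n.
Proof.
have [_ V1 _ V3 _] := HV.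
have [k] := ubnP (size l); elim: k l n => // k IH l n lk wl.
have [->|l0] := pselect (l = [::]); first by move=> g /= ->.
have hn := half_pos n; have hn1 : ((/ 2) ^ n.+1 = (/ 2) ^ n / 2)%R by rewrite /=; lra.
(* Both outer words weigh less than [(/ 2) ^ n.+1], so induction puts them in [V n.+1]. The middle
   letter weighs less than [(/ 2) ^ n], so its index exceeds [n]. The triple product then lies in
   [V n]. *)
have [|||//|l1 [i [l2 [E h1 h2]]]] := @weight_split ((/ 2) ^ n.+1) 0 l; [lra|lra|lra|].
move: lk wl; rewrite E size_cat /= weight_cat /= => lk wl g.
have h1p := weight_ge0 l1; have h2p := weight_ge0 l2.
move=> /prods_cat [a [_ [ha [b [c [Vb hc ->]]] ->]]].
rewrite gmulA; apply: V3.
- apply: (IH l1) ha; last lra.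
  by rewrite addnS ltnS in lk; apply: leq_ltn_trans (leq_addr _ _) lk.
- have /half_lt_inv : ((/ 2) ^ i < (/ 2) ^ n)%R by lra.
  by move=> ni; exact: (nbhd_mono ni Vb).
- apply: (IH l2) hc; last lra.
  by rewrite addnS ltnS in lk; apply: leq_ltn_trans (leq_addl _ _) lk.
Qed.

End Chains.
End TopologicalGroup.

(** * Borel actions *)

(** The infimum is described by the numbers strictly above it, the form in which measurability and
    continuity of the gauges are checked. *)
Lemma inf_ex (E : R -> Prop) : (exists r, E r) -> (forall r, E r -> (0 <= r)%R) ->
  exists m, forall r, (m < r)%R <-> exists v, E v /\ (v < r)%R.
Proof.
move=> [r0 Er0] E0.
have [||m [ub lub]] := completeness (fun r => E (- r)%R).
- by exists 0%R => r /E0; lra.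
- by exists (- r0)%R; rewrite Ropp_involutive.
exists (- m)%R => r; split.
  move=> mr; apply: contrapT => H.
  have : (m <= - r)%R; last lra.
  apply: lub => v Ev; apply: Rnot_lt_le => h; apply: H.
  by exists (- v)%R; split => //; lra.
move=> [v [Ev vr]]; have : (- v <= m)%R by apply: ub; rewrite Ropp_involutive.
by lra.
Qed.

Lemma prod_sigma_section (A B : Type) (SA : set (set A)) (SB : set (set B)) (a : A) C :
  sigma_algebra setT SB -> prod_sigma SA SB C -> SB [set b | C (a, b)].
Proof.
move=> HB; apply: (salg_preimage (f := fun b => (a, b))) => // _ [U [V [_ [SV ->]]]].
rewrite (_ : _ @^-1` _ = [set b | U a /\ V b]); last by apply/seteqP; split.
by apply: (salg_and HB) => //; exact: (salg_cst HB).
Qed.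

Lemma standard_borel_separating (X : Type) (S : set (set X)) : standard_borel S ->
  sigma_algebra setT S /\ exists A : nat -> set X,
    (forall n, S (A n)) /\ forall x y, (forall n, A n x <-> A n y) -> x = y.
Proof.
move=> [op [pX ->]]; split; first exact: salg_gen.
have [d [[dpos [d0 [dsym dtri]]] cd od [B [_ Bo Bb]]]] := polish_base pX.
exists B; split; first by move=> n; apply: sub_sigma_algebra; exact: Bo.
move=> x y H; apply/d0/Rle_antisym => //; apply: Rnot_lt_le => h.
have [n [Bx hB]] := Bb x _ h; have By := (H n).1 Bx.
by have := hB y By; lra.
Qed.

Section BorelGSpace.
Variables (G : topologicalType) (mul : G -> G -> G) (inv : G -> G) (one : G).
Hypothesis HG : polish_group mul inv one.
Local Notation "x ** y" := (mul x y) (at level 40, left associativity).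
Variables (X : Type) (S : set (set X)) (act : G -> X -> X).
Hypotheses (HS : sigma_algebra setT S) (Hact : borel_action mul one S act).
Variable A : nat -> set X.
Hypotheses (SA : forall n, S (A n)) (Asep : forall x y, (forall n, A n x <-> A n y) -> x = y).
Variables (B : nat -> set G).
Hypotheses (Bo : forall n, open (B n))
  (Bb : forall (U : set G) x, open U -> U x -> exists n, B n x /\ B n `<=` U).
Variable V : nat -> set G.
Hypothesis HV : nbhd_chain mul inv one V.

Let pG : polish_top [set U : set G | open U].
Proof. by case: HG => _ []. Qed.

Let actM g h x : act (g ** h) x = act g (act h x).
Proof. by case: Hact => _ []. Qed.

Let act1 x : act one x = x.
Proof. by case: Hact. Qed.

Definition hits (n : nat) (a : G) (l : seq nat) (x : X) : Prop :=
  ~ meager ([set g | A n (act g x)] `&` [set g | prods mul one V l (inv a ** g)]).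

Lemma hits_meas n a i l : S [set x | hits n a (i :: l) x].
Proof.
case: Hact => _ [_ mact].
have [_ H] := section_meager_borel pG HS Bo Bb (mact _ (SA n)).
apply: (salgC HS); apply: H; apply: (open_lmul HG).
exact: (prods_open HG HV).
Qed.

Lemma act_borel n x : borel_sets [set g | A n (act g x)].
Proof.
case: Hact => _ [_ mact].
by have [+ _] := section_meager_borel pG HS Bo Bb (mact _ (SA n)); apply.
Qed.

(** Passing from [act h x] to [act h' x] right-translates the set of group elements by
    [h ** inv h']. Translation preserves meagerness, and this factor is absorbed by the appended
    letter [i]. *)
Lemma hits_act n a i l h h' x : V i (h ** inv h') ->
  hits n a l (act h x) -> hits n a (l ++ [:: i]) (act h' x).
Proof.
move=> Vh; apply: contra_not => /(meager_rmul HG (h ** inv h')).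
apply: meager_sub => g [Ag hg]; split => /=.
  by rewrite -actM (gmulA HG) (gmulrKV HG) actM.
rewrite (gmulA HG); apply/(prods_cat HG); exists (inv a ** g), (h ** inv h').
by split => //=; exists (h ** inv h'), one; rewrite (gmulr1 HG).
Qed.

(** The value 2 keeps the infimum defined when no word is hit. It exceeds every [(/ 2) ^ i], so it
    cannot interfere when points are separated. *)
Lemma gauge_ex : exists phi : nat -> G -> X -> R, forall n a x r,
  (phi n a x < r)%R <-> (2 < r)%R \/ exists i l, (weight (i :: l) < r)%R /\ hits n a (i :: l) x.
Proof.
suff H n a x : exists m, forall r,
    (m < r)%R <-> (2 < r)%R \/ exists i l, (weight (i :: l) < r)%R /\ hits n a (i :: l) x.
  have /choice [phi hphi] : forall p : nat * G * X, exists m, forall r, (m < r)%R <->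
      (2 < r)%R \/ exists i l, (weight (i :: l) < r)%R /\ hits p.1.1 p.1.2 (i :: l) p.2.
    by move=> [[n a] x]; exact: H.
  by exists (fun n a x => phi (n, a, x)) => n a x; exact: hphi (n, a, x).
have [||m hm] := @inf_ex (fun v => v = 2%R \/
    exists i l, v = weight (i :: l) /\ hits n a (i :: l) x).
- by exists 2%R; left.
- by move=> r [->|[i [l [-> _]]]]; [lra|exact: weight_ge0].
exists m => r; rewrite hm; split.
  by move=> [v [[->|[i [l [-> h]]]] vr]]; [left|right; exists i, l].
move=> [r2|[i [l [wr h]]]]; first by exists 2%R; split => //; left.
by exists (weight (i :: l)); split => //; right; exists i, l.
Qed.

Lemma orbit_map : exists psi : X -> nat -> R,
  [/\ forall j r, S [set x | (psi x j < r)%R],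
      forall e h x, (0 < e)%R -> exists W, [/\ open W, W h &
        forall h' j, W h' -> (Rabs (psi (act h x) j - psi (act h' x) j) < e)%R] &
      forall x y, psi x = psi y -> orbit_rel act x y].
Proof.
have [phi hphi] := gauge_ex.
have [Vo V1 Vs _ Vb] := HV.
have /choice [a ha] : forall k, exists a, B k !=set0 -> B k a.
  move=> k; have [[a Ba]|nB] := pselect (B k !=set0); first by exists a.
  by exists one.
exists (fun x j => if (unpickle j : option (nat * nat)) is Some p then phi p.1 (a p.2) x else 0%R).
split.
- move=> j r; case: (unpickle j) => [p|]; last exact: (salg_cst HS).
  rewrite (_ : mkset _ = [set x | (2 < r)%R \/ exists i, exists l,
      (weight (i :: l) < r)%R /\ hits p.1 (a p.2) (i :: l) x]); last first.
    by apply/seteqP; split => x /=; rewrite hphi.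
  apply: (salg_or HS); first exact: (salg_cst HS).
  apply: (salg_ex HS) => i; apply: (salg_ex HS) => l; apply: (salg_and HS).
    exact: (salg_cst HS).
  exact: hits_meas.
- move=> e h x e0; have [i hi] := half_small (e := e / 2) ltac:(lra).
  (* The letter [i] appended by [hits_act] costs less than [e / 2], uniformly in [n] and [b]. *)
  have half n b k k' : V i (k ** inv k') -> forall r,
      (phi n b (act k x) < r)%R -> (phi n b (act k' x) < r + e / 2)%R.
    move=> Vk r /hphi H; apply/hphi; case: H => [|[j [l [wl hl]]]]; first by left; lra.
    right; exists j, (l ++ [:: i]); split.
      by rewrite -cat_cons weight_cat [weight [:: i]]/=; lra.
    by rewrite -cat_cons; exact: hits_act Vk hl.
  exists [set h' | V i (h ** inv h')]; split.
  + exact: (open_inv HG (open_lmul HG h (Vo i))).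
  + by rewrite /= (gmulrV HG).
  + move=> h' j Vh; case: (unpickle j) => [[n k]|] /=; last first.
      by rewrite Rminus_diag Rabs_R0.
    have Vh' : V i (h' ** inv h).
      by have := Vs _ _ Vh; rewrite (ginvM HG) (ginvK HG).
    (* The slack [e / 4] provides the strict inequality that [half] asks for; the total stays below
       [e]. *)
    have h1 := half n (a k) _ _ Vh (phi n (a k) (act h x) + e / 4)%R.
    have h2 := half n (a k) _ _ Vh' (phi n (a k) (act h' x) + e / 4)%R.
    by apply: Rabs_def1; [have := h2 ltac:(lra)|have := h1 ltac:(lra)]; lra.
- move=> x y E.
  have Ephi n k : phi n (a k) x = phi n (a k) y.
    have := congr1 (fun u => u (pickle (n, k))) E.
    by rewrite pickleK.
  (* Such a [g] even forces [x = y]; it is found among generic group elements. *)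
  suff [g gxy] : exists g, act g x = act g y.
    by exists (inv g ** g); rewrite actM gxy -actM (gmulV HG) act1.
  (* A set comeager near [a k] for [x] and meager there for [y] separates the gauges. *)
  have key n u v : (forall k, phi n (a k) u = phi n (a k) v) ->
      meager ([set g | A n (act g u)] `\` [set g | A n (act g v)]).
    move=> Euv; apply: contrapT => nm.
    have HB : sigma_algebra setT (@borel_sets G) by exact: salg_gen.
    have bD : borel_sets ([set g | A n (act g u)] `\` [set g | A n (act g v)]).
      by apply: (salg_and HB); [exact: act_borel|exact: (salgC HB (act_borel n v))].
    rewrite -[X in meager X]setIT in nm.
    have [O [oO [g Og] _ mO]] := nonmeager_comeager bD openT nm.
    have [k [Bg BO]] := Bb oO Og.
    have Oa : O (a k) by apply/BO/ha; exists g.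
    have [|i Vi] := Vb [set g | O (a k ** g)] (open_lmul HG _ oO).
      by rewrite /= (gmulr1 HG).
    have Oi b : V i (inv (a k) ** b) -> O b by move=> /Vi /=; rewrite (gmulKV HG).
    have hi := half_pos i.
    (* The one-letter word [i.+1] is hit for [u], since the set of [u] is comeager around [a k]; its
       weight is half of [(/ 2) ^ i]. *)
    have : (phi n (a k) u < (/ 2) ^ i)%R.
      apply/hphi; right; exists i.+1, [::]; split; first by rewrite /=; lra.
      move=> m; suff : [set g | V i.+1 (inv (a k) ** g)] = set0.
        by move=> /seteqP[/(_ (a k)) /= + _]; rewrite (gmulV HG); apply; exact: V1.
      apply: (baire pG); first exact: (open_lmul HG _ (Vo _)).
      apply: meager_sub (meager_setU m mO) => b /= Vb'.
      have [Ab|nAb] := pselect (A n (act b u)).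
        left; split => //=; exists (inv (a k) ** b), one.
        by split => //; rewrite (gmulr1 HG).
      right; split; last by case.
      by apply: Oi; exact: (nbhd_mono HG HV (leqnSn i)).
    (* The same bound for [v] would give a hit word whose product lies in [V i], hence, translated
       by [a k], in [O], where the set of [v] is meager. *)
    rewrite Euv => /hphi [|[j [l [wl]]]].
      have : ((/ 2) ^ i <= 1)%R by elim: (i) => [|q IH] /=; lra.
      by lra.
    apply; apply: meager_sub mO => b [/= Ab hb]; split; last by case.
    by apply: Oi; apply: (prods_small HG HV wl).
  apply: contrapT => ng.
  (* If no [g] worked, each would lie in one of the countably many meager symmetric differences, as
     the [A n] separate points. *)
  have : [set: G] = set0.
    apply: (baire pG); first exact: openT.
    apply: (@meager_sub _ _ (\bigcup_n
      (([set g | A n (act g x)] `\` [set g | A n (act g y)]) `|`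
       ([set g | A n (act g y)] `\` [set g | A n (act g x)])))); last first.
      by apply: meager_bigcup => n; apply: meager_setU; apply: key.
    move=> g _; apply: contrapT => H; apply: ng; exists g; apply: Asep => n.
    split => h; apply: contrapT => nh; apply: H; exists n => //.
      by left.
    by right.
  by move=> /seteqP[/(_ one) + _]; apply.
Qed.

End BorelGSpace.

(** * The universal action *)

Section Universal.
Variables (G : topologicalType) (mul : G -> G -> G) (inv : G -> G) (one : G).
Hypothesis HG : polish_group mul inv one.
Variable X0 : topologicalType.
Hypothesis HX0 : universal_polish X0.
Local Notation "x ** y" := (mul x y) (at level 40, left associativity).

(** As a preimage, the translate is easily seen to be closed, and the action laws reduce to those of
    [mul] and [inv]. *)
Lemma Zact_setE g (F : set (X0 * G)) :
  Zact_set mul g F = [set q | F (q.1, inv g ** q.2)].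
Proof.
apply/seteqP; split => [_ [[x h] Fx <-]|[x h] /= Fx] /=.
  by rewrite (gmulVK HG).
by exists (x, inv g ** h) => //=; rewrite (gmulKV HG).
Qed.

Lemma Zact_closed g (F : set (X0 * G)) : closed F /\ F !=set0 ->
  closed (Zact_set mul g F) /\ Zact_set mul g F !=set0.
Proof.
move=> [cF [p Fp]]; split; last by exists (p.1, g ** p.2), p.
rewrite Zact_setE (_ : mkset _ = ~` [set q | (~` F) (q.1, inv g ** q.2)]); last first.
  by apply/seteqP; split => q /=; [move=> h; apply|exact: contrapT].
apply: open_closedC; apply/open_prodP => -[x h] /= nF.
have [V [W [oV oW Vx Wh VW]]] := (open_prodP _).1 (closed_openC cF) _ nF.
exists V, [set k | W (inv g ** k)]; split => //; first exact: (open_lmul HG).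
by move=> [y k] [/= Vy Wk]; exact: (VW (y, _)).
Qed.

Definition Zact (g : G) (F : Zsp X0 G) : Zsp X0 G :=
  exist _ (Zact_set mul g (proj1_sig F)) (Zact_closed g (proj2_sig F)).

Lemma EZ_in_CG : in_CG mul one (@effros X0 G) (@EZ X0 G mul).
Proof.
have [_ [_ pG]] := HG; have [pX _] := HX0.
split; first exact: effros_standard.
exists Zact; split; last first.
  move=> F F'; split; first by move=> [g E]; exists g; exact: Zsp_eq.
  by move=> [g <-]; exists g.
split; [|split].
- move=> F; apply: Zsp_eq; rewrite /= Zact_setE (ginv1 HG).
  by apply/seteqP; split => -[x h] /=; rewrite (gmul1 HG).
- move=> g h F; apply: Zsp_eq; rewrite /= !Zact_setE (ginvM HG).
  by apply/seteqP; split => -[x k] /=; rewrite (gmulA HG).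
have HP : sigma_algebra setT (prod_sigma (@borel_sets G) (@effros X0 G)) by exact: salg_gen.
apply: salg_preimage => // _ [U [oU ->]].
have [d [md _ od [C [_ Co Cb]]]] := polish_base (polish_prod pX pG).
have [dG [mdG _ odG [B' [_ Bo' Bb']]]] := polish_base pG.
(* By continuity of multiplication, a translate of [F] by [g] meets [U] exactly when some fitting
   pair has [g] in its first set and [F] meeting its second: a countable union of measurable
   rectangles. *)
pose fits (p : nat * nat) := forall g q, B' p.1 g -> C p.2 q -> U (q.1, g ** q.2).
rewrite (_ : _ @^-1` _ = [set p | exists i, fits i /\ (B' i.1 `*`
    [set F : Zsp X0 G | (proj1_sig F `&` C i.2) !=set0]) p]).
  apply: (salg_ex HP) => i; apply: (salg_and HP); first exact: (salg_cst HP).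
  apply: sub_sigma_algebra; do 2 eexists; split; [|split; [|reflexivity]].
    by apply: sub_sigma_algebra; exact: Bo'.
  by apply: sub_sigma_algebra; exists (C i.2); split => //; exact: Co.
apply/seteqP; split => -[g F] /=.
  move=> [_ [[[x h] Fx <-] /= Ux]].
  have [V [W [oV oW /= Vx Wg VW]]] := (open_prodP _).1 oU _ Ux.
  have [W1 [W2 [oW1 oW2 W1g W2h H]]] := gmul_open HG oW Wg.
  have [e [e0 he]] : exists e, (0 < e)%R /\ forall k, (dG g k < e)%R -> W1 k.
    by move: oW1; rewrite -[open W1]/([set U : set G | open U] W1) odG => /(_ _ W1g).
  have [n [Bn hn]] := Bb' g e e0.
  have oVW : open (V `*` W2).
    apply/open_prodP => p [Vp Wp]; exists V, W2; split => //.
  have [f [f0 hf]] : exists f, (0 < f)%R /\ forall q, (d (x, h) q < f)%R -> (V `*` W2) q.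
    by move: oVW; rewrite -[open _]/([set U : set (X0 * G) | open U] _) od => /(_ (x, h)); apply.
  have [m [Cm hm]] := Cb (x, h) f f0.
  exists (n, m); split; last by split => //; exists (x, h).
  move=> k q /= /hn /he W1k /hm /hf [Vq W2q].
  by apply: VW; split => //=; exact: H.
move=> [[n m] [/= hf [Bg [q [Fq Cq]]]]].
by exists (q.1, g ** q.2); split; [exists q|exact: hf].
Qed.

Lemma Aproj_act g F F' : Zact_set mul g (proj1_sig F) = proj1_sig F' ->
  Aproj F `<=` @Aproj X0 G F'.
Proof.
by move=> E x [h Fx]; exists (g ** h); rewrite -E; exists (x, h).
Qed.

(** The projection of [F] is non-empty, and translation carries it into that of [F']. *)
Lemma EZ_not_DisjG F F' : EZ mul F F' -> ~ @DisjG X0 G F F'.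
Proof.
move=> [g E] D; case: (proj2_sig F) => _ [[x h] Fx].
have Ax : Aproj F x by exists h.
have : (Aproj F `&` Aproj F') x by split => //; exact: Aproj_act E x Ax.
by rewrite D.
Qed.

Lemma orbit_embedding (X : Type) (S : set (set X)) (E : X -> X -> Prop) :
  in_CG mul one S E -> exists f : X -> Zsp X0 G,
    borel_hom S (@effros X0 G) E (neg_rel E) (@EZ X0 G mul) (@DisjG X0 G) f.
Proof.
move=> [sX [act [Hact HE]]].
have [_ [_ pG]] := HG; have [pX embed] := HX0.
have [HS [A [SA Asep]]] := standard_borel_separating sX.
have [V HV] := nbhd_chain_ex HG.
have [dG [mdG _ odG [B [_ Bo Bm]]]] := polish_base pG.
have Bb (U : set G) x : open U -> U x -> exists n, B n x /\ B n `<=` U.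
  rewrite -[open U]/([set U : set G | open U] U) odG => /[apply] -[e [e0 he]].
  by have [n [Bn hn]] := Bm x e e0; exists n; split => // y /hn /he.
have [psi [psi_meas psi_cont psi_sep]] := orbit_map HG HS Hact SA Asep Bo Bb HV.
(* With the identity as code, [cdist c] is a product metric on real sequences. *)
pose c := fun u : nat -> R => u.
have pR : polish_top (metric_open (cdist c)).
  apply: coded_polish; first by move=> ? ?.
  by move=> z _; exists z.
have [e [einj [_ eop]]] := embed _ _ pR.
have [act1 [actM mact]] := Hact.
pose kap x := e (psi x).
have kap_meas U : open U -> S [set x | U (kap x)].
  move=> oU; have /(coded_meas (c := c) (f := psi) HS psi_meas) : metric_open (cdist c) (e @^-1` U).
    by apply/eop; exists U.
  by [].
have kap_open U x : open U -> open [set h | U (kap (act (inv h) x))].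
  move=> oU; apply: (open_inv HG (U := [set h | U (kap (act h x))])).
  have /cdist_openP oeU : metric_open (cdist c) (e @^-1` U) by apply/eop; exists U.
  apply: open_of_nbhs_sets => h /= /oeU [N [r [r0 hr]]].
  have [W [oW Wh hW]] := psi_cont r h x r0.
  by exists W; split => // h' Wh'; apply: hr => i _; exact: hW.
(* Continuity of [psi] along the orbit makes this the graph of a continuous map on [G], hence
   closed. Its projection to [X0] is the image of the orbit of [x]. *)
pose graph x : set (X0 * G) := [set p | p.1 = kap (act (inv p.2) x)].
have graph_closed x : closed (graph x).
  have [d [md [_ [od _]]]] := pX; have [dpos [d0 [dsym dtri]]] := md.
  have odE U : open U <-> metric_open d U by rewrite -od.
  have ball z r : open [set y | (d z y < r)%R] by apply/odE; exact: metric_ball_open.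
  rewrite (_ : graph x = ~` [set p | p.1 <> kap (act (inv p.2) x)]); last first.
    by apply/seteqP; split => p; [move=> h; apply|exact: contrapT].
  apply: open_closedC; apply/open_prodP => -[z h] /= nz.
  have r0 : (0 < d z (kap (act (inv h) x)))%R.
    by have := dpos z (kap (act (inv h) x)) => -[//|/esym/d0].
  set r := d _ _ in r0.
  exists [set y | (d z y < r / 2)%R], [set k | (d (kap (act (inv h) x)) (kap (act (inv k) x)) < r / 2)%R].
  split => /=.
  - exact: ball.
  - exact: (kap_open _ x (ball (kap (act (inv h) x)) (r / 2)%R)).
  - by rewrite (d0 _ _).2//; lra.
  - by rewrite (d0 _ _).2//; lra.
  - move=> [y k] [/= h1 h2] yk; rewrite yk in h1.
    have := dtri z (kap (act (inv k) x)) (kap (act (inv h) x)).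
    by rewrite (dsym (kap (act (inv k) x))) -/r; lra.
have graph_ne x : graph x !=set0 by exists (kap (act (inv one) x), one).
pose f x : Zsp X0 G := exist _ (graph x) (conj (graph_closed x) (graph_ne x)).
exists f; split; [|split].
- apply: salg_preimage => // _ [U [oU ->]].
  have /choice [a ha] : forall k, exists a, B k !=set0 -> B k a.
    move=> k; have [[a Ba]|nB] := pselect (B k !=set0); first by exists a.
    by exists one.
  (* A continuous graph that meets an open set already meets it over the dense sequence [a]. *)
  rewrite (_ : _ @^-1` _ = [set x | exists k, U (kap (act (inv (a k)) x), a k)]).
    apply: (salg_ex HS) => k.
    have oUk : open [set z | U (z, a k)].
      apply: open_of_nbhs_sets => z /= Uz.
      have [V1 [W1 [oV1 oW1 Vz Wa VW]]] := (open_prodP _).1 oU _ Uz.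
      by exists V1; split => // y Vy; exact: (VW (y, a k)).
    have Sk := kap_meas _ oUk.
    exact: (prod_sigma_section (inv (a k)) HS (mact _ Sk)).
  apply/seteqP; split => x /=; last first.
    by move=> [k Uk]; exists (kap (act (inv (a k)) x), a k); split.
  move=> [[z h] [/= zh Uz]]; rewrite /graph /= in zh; rewrite zh in Uz.
  have [V1 [W1 [oV1 oW1 Vz Wa VW]]] := (open_prodP _).1 oU _ Uz.
  have oI := openI (kap_open _ x oV1) oW1.
  have [k [Bh BI]] := Bb _ h oI (conj Vz Wa).
  have [Vk Wk] : ([set h | V1 (kap (act (inv h) x))] `&` W1) (a k).
    by apply/BI/ha; exists h.
  by exists k; apply: VW.
(* Equivariance: both sides evaluate [kap] at [act (inv h ** g) x]. *)
- move=> x y /HE [g <-]; exists g; rewrite Zact_setE /= /graph.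
  apply/seteqP; split => -[z h] /= ->; congr kap.
    by rewrite (ginvM HG) (ginvK HG) actM.
  by rewrite (ginvM HG) (ginvK HG) actM.
(* A common point of the projections equates [psi] at a point of each orbit, so the two orbits
   coincide. *)
- move=> x y nE; apply/seteqP; split => // z [[h /= zh] [k /= zk]].
  apply: nE; apply/HE; rewrite /graph /= in zh zk.
  have /psi_sep [g gE] : psi (act (inv h) x) = psi (act (inv k) y).
    by apply: einj; rewrite -/(kap _) -zh zk.
  exists (k ** (g ** inv h)).
  by rewrite !actM gE -actM (gmulrV HG) act1.
Qed.

End Universal.

Theorem mainTheorem4 (G : topologicalType) (mul : G -> G -> G) (inv : G -> G) (one : G)
  (HG : polish_group mul inv one)
  (X0 : topologicalType) (HX0 : universal_polish X0) :
  complete_for_CG mul one (@effros X0 G) (@EZ X0 G mul) (@DisjG X0 G) /\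
  (in_CG mul one (@effros X0 G) (@EZ X0 G mul) /\
   forall (X : Type) (SX : set (set X)) (E : X -> X -> Prop),
     in_CG mul one SX E -> borel_reducible SX (@effros X0 G) E (@EZ X0 G mul)).
Proof.
have EZC := EZ_in_CG HG HX0; split; [split|split => //].
- by move=> X SX E /(orbit_embedding HG HX0).
(* The identity of [Zsp X0 G] is the second homomorphism, because disjoint projections exclude a
   common orbit. *)
- exists (Zsp X0 G), (@effros X0 G), (@EZ X0 G mul); split => //.
  exists (fun F => F); split; first by move=> U.
  by split=> // F F' D /EZ_not_DisjG; apply.
- move=> X SX E /(orbit_embedding HG HX0) [f [mf [h1 h2]]].
  exists f; split => // x y; split; first exact: h1.
  move=> ZE; apply: contrapT => nE.
  exact: (EZ_not_DisjG ZE (h2 _ _ nE)).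
Qed.
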